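(* Let $G$ be the icosahedral group of all rotations of $S^2$ preserving a fixed regular dodecahedron centered at the origin. For any finite subset $\alpha$ of $S^2$, $\mathcal{A}_\alpha=G\ (\simeq A_5)$ if and only if $\alpha$ is a union of (one or more) elements of $$\{V_I,F_I,E_I\}\cup\{B_I(X)\mid X\in S^2\setminus(V_I\cup F_I\cup E_I)\}.$$
   Context: $S^2$ is the unit sphere, identified with the extended complex plane $\widehat{\mathbb{C}}$ by stereographic projection; rotations of $S^2$ are thereby regarded as linear fractional transformations. For a finite subset $\alpha$, $\mathcal{A}_\alpha$ is the group of linear fractional transformations $h$ with $h(\alpha)=\alpha$. The dodecahedron is inscribed in $S^2$. $V_I$ is its set of $20$ vertices; $F_I$ and $E_I$ are the radial projections from the origin to $S^2$ of the centers of its $12$ faces and of the midpoints of its $30$ edges, respectively. For $X\in S^2\setminus(V_I\cup F_I\cup E_I)$, $B_I(X)$ is the $G$-orbit of $X$. *)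

(* Defs.v *)
From mathcomp Require Import all_boot all_order all_algebra all_fingroup.
From mathcomp Require Import alt.
From mathcomp Require Import finmap complex.
From mathcomp Require Import all_classical all_reals all_analysis.

Set Implicit Arguments.
Unset Strict Implicit.
Unset Printing Implicit Defensive.

Import Order.TTheory GRing.Theory Num.Theory.

Local Open Scope classical_set_scope.
Local Open Scope ring_scope.

Section EuclideanSpace.
Variable R : realType.
Implicit Types (u v x : 'rV[R]_3) (Q : 'M[R]_3) (V f P : set 'rV[R]_3).

Definition dotv u v : R := (u *m v^T) 0 0.
Definition normv v : R := Num.sqrt (dotv v v).

Definition vec3 (a b c : R) : 'rV[R]_3 := \row_(i < 3) [:: a; b; c]`_i.

Definition orthogonal_mx Q : Prop := Q *m Q^T = 1%:M.

Record sphere : Type := Sphere {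
  sphere_val : 'rV[R]_3;
  sphere_valP : dotv sphere_val sphere_val == 1 }.

Definition golden : R := (1 + Num.sqrt 5) / 2.

(* The usual coordinates (+-1, +-1, +-1), (0, +-1/phi, +-phi) and the cyclic
   permutations of the latter; these 20 points have norm sqrt 3. *)
Definition standard_dodecahedron_vertices : set 'rV[R]_3 :=
  [set v | exists a b c : bool,
     let s (e : bool) : R := (-1) ^+ e in
     v \in [:: vec3 (s a) (s b) (s c);
               vec3 0 (s a / golden) (s b * golden);
               vec3 (s a / golden) (s b * golden) 0;
               vec3 (s a * golden) 0 (s b / golden)]].

(* V is the vertex set of a regular dodecahedron inscribed in the unit sphere
   and centered at the origin, in arbitrary position. *)
Definition regular_dodecahedron_vertices V : Prop :=
  exists2 Q, orthogonal_mx Q &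
    V = [set (Num.sqrt 3)^-1 *: (v *m Q)
          | v in standard_dodecahedron_vertices].

Definition convex_hull V : set 'rV[R]_3 :=
  smallest (@convex_set R 'rV[R]_3) V.

(* f is the set of vertices lying on some supporting plane of the polytope
   with vertex set V. *)
Definition supported_vertices V f : Prop :=
  exists u (c : R),
    [/\ u != 0, (forall v, V v -> dotv u v <= c) &
        f = [set v | V v /\ dotv u v = c]].

Definition is_face V f : Prop :=
  supported_vertices V f /\
  exists p q r, [/\ f p, f q, f r & \rank (col_mx (q - p) (r - p)) = 2%N].

Definition is_edge V p q : Prop :=
  p != q /\ supported_vertices V [set p; q].

Definition centroid f : 'rV[R]_3 :=
  (#|` fset_set f|%:R)^-1 *: \sum_(v \in f) v.

Definition radial_projection v : 'rV[R]_3 := (normv v)^-1 *: v.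

Definition vertex_points V : set sphere := [set x : sphere | V (sphere_val x)].

Definition face_points V : set sphere :=
  [set x : sphere |
    exists2 f, is_face V f & sphere_val x = radial_projection (centroid f)].

Definition edge_points V : set sphere :=
  [set x : sphere | exists p q,
     is_edge V p q /\ sphere_val x = radial_projection (2^-1 *: (p + q))].

(* The rotations of the sphere that preserve the solid P. *)
Definition rotation_group P : set (sphere -> sphere) :=
  [set h | exists Q,
     [/\ orthogonal_mx Q, \det Q = 1,
         (forall x : sphere, sphere_val (h x) = sphere_val x *m Q) &
         [set p *m Q | p in P] = P]].

Definition orbit_under (G : set (sphere -> sphere)) (x : sphere) :
    set sphere :=
  [set h x | h in G].

End EuclideanSpace.

Section Moebius.
Variable R : realType.

(* The extended complex plane; None is the point at infinity. *)
Definition extC : Type := option R[i].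

(* Stereographic projection from the north pole (0, 0, 1) onto the equatorial
   plane. *)
Definition stereo (x : sphere R) : extC :=
  let p := sphere_val x in
  if p 0 2 == 1 then None
  else Some ((p 0 0 / (1 - p 0 2) +i* (p 0 1 / (1 - p 0 2)))%C).

Definition linear_fractional (M : 'M[R[i]]_2) (z : extC) : extC :=
  match z with
  | Some w =>
      if M 1 0 * w + M 1 1 == 0 then None
      else Some ((M 0 0 * w + M 0 1) / (M 1 0 * w + M 1 1))
  | None => if M 1 0 == 0 then None else Some (M 0 0 / M 1 0)
  end.

(* h is a linear fractional transformation once the sphere is identified with
   the extended complex plane. *)
Definition is_lft (h : sphere R -> sphere R) : Prop :=
  exists2 M : 'M[R[i]]_2, \det M != 0 &
    forall x, stereo (h x) = linear_fractional M (stereo x).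

Definition lft_stabilizer (alpha : set (sphere R)) :
    set (sphere R -> sphere R) :=
  [set h | is_lft h /\ h @` alpha = alpha].

End Moebius.

(* G, a set of self-maps of T, is a group under composition isomorphic to the
   alternating group A_5. *)
Definition isomorphic_to_A5 (T : Type) (G : set (T -> T)) : Prop :=
  exists f : {perm 'I_5} -> (T -> T),
    [/\ {in Alt 'I_5 &, forall s t, f (s * t)%g = f s \o f t},
        {in Alt 'I_5 &, injective f},
        f 1%g = id &
        [set f s | s in [set` Alt 'I_5]] = G].

(* Main.v *)
Require Import Defs.
From Stdlib Require Import ZArith.
From mathcomp Require Import all_boot all_order all_algebra all_fingroup.
From mathcomp Require Import alt gseries complex finmap ring lra zify ssrZ.
From mathcomp Require Import all_classical all_reals all_analysis.

(** Let alpha be finite.  Its stabilizer A among the linear fractional maps is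
    G exactly when alpha is nonempty and G-stable ([stabilizer_eq_iff]), and a
    nonempty G-stable set is the same thing as a nonempty union of G-orbits
    ([union_of_orbitsP]).  So besides this equivalence it has to be seen that
    each of V_I, F_I, E_I is a single G-orbit.

    The substance of the equivalence is that no finite group A of linear
    fractional maps properly contains G.  A linear fractional map fixing three
    points is the identity, so A is finite as soon as it preserves a finite set
    with at least three points; and a nontrivial element of finite order fixes
    exactly two points ([is_lft_two_fixed]).  On a finite A-stable set S that
    contains all these fixed points, Burnside's count of the orbits gives
    |S| + 2 (|A| - 1) = k |A|, where k is the number of orbits.  Every G-orbit,
    hence every A-orbit, has at least three points, and then the sizes of the
    nonregular orbits satisfy an equation whose solutions all have |A| <= 60
    ([orbit_sizes_bound]).  As A contains the 60 elements of G, it equals G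
    ([lft_group_le60]).  Conversely the empty set is excluded because some
    linear fractional map, such as a dilation, is not a rotation.

    That rotations are linear fractional is proved with Pauli matrices: s(x) is
    the Hermitian involution whose fixed line in C^2 is the stereographic image
    of x, a half-turn about u acts on s(x) by conjugation with s(u), and every
    rotation is a half-turn composed with a rotation about the vertical axis.

    All facts on the dodecahedron itself are finite computations in Z[phi],
    phi being the golden ratio.  A table of 60 pairs couples the permutations
    of the five inscribed cubes with the matrices of the rotations.  It is
    closed under products, its permutations form a subgroup of index 2 of S_5,
    which by the simplicity of A_5 is A_5 ([code_group_Alt]), and its matrices
    are all the rotations that preserve the vertices ([rotation_icos]).  It acts
    transitively on vertices, on faces and on edges; here the normal of a face
    is found from three of its vertices ([standard_face]), and a pair of
    nonadjacent vertices is not an edge because the segment that joins them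
    meets another chord of the polytope or lies too deep inside it
    ([standard_edge]).  Finally a rotation preserves the convex hull if and only
    if it preserves the vertices, because by strict convexity of the ball they
    are the only points of the hull on the sphere ([rotation_hullP]). *)

Set Implicit Arguments.
Unset Strict Implicit.
Unset Printing Implicit Defensive.

Import Order.TTheory GRing.Theory Num.Theory.

Local Delimit Scope Z_scope with ZZ.

(** * Exact coordinates over the golden integers *)

(** The pair (a, b) stands for a + b phi. *)
Definition zphi : Type := (Z * Z)%type.
Definition zvec : Type := (zphi * zphi * zphi)%type.
(** Three rows.  The entries of the rotations of the dodecahedron lie in
    (1/2) Z[phi], so [zmat] is used for the double of a rotation matrix. *)
Definition zmat : Type := (zvec * zvec * zvec)%type.
(** A permutation of {0, ..., 4} as the list of its values, on which products
    can be evaluated. *)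
Definition pcode : Type := seq nat.

Definition zcst (n : Z) : zphi := (n, 0%ZZ).
Definition zadd (x y : zphi) : zphi := (Z.add x.1 y.1, Z.add x.2 y.2).
Definition zopp (x : zphi) : zphi := (Z.opp x.1, Z.opp x.2).
Definition zmul (x y : zphi) : zphi :=
  (Z.add (Z.mul x.1 y.1) (Z.mul x.2 y.2),
   Z.add (Z.add (Z.mul x.1 y.2) (Z.mul x.2 y.1)) (Z.mul x.2 y.2)).
(** A sufficient test for a + b phi > 0: the Fibonacci quotients 21/13 and
    34/21 enclose phi, and an affine function that is positive at both ends of
    an interval is positive inside. *)
Definition zpos (x : zphi) : bool :=
  Z.ltb 0 (Z.add (Z.mul 13 x.1) (Z.mul 21 x.2)) &&
  Z.ltb 0 (Z.add (Z.mul 21 x.1) (Z.mul 34 x.2)).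

Definition zvadd (u v : zvec) : zvec :=
  (zadd u.1.1 v.1.1, zadd u.1.2 v.1.2, zadd u.2 v.2).
Definition zvscale (a : zphi) (u : zvec) : zvec :=
  (zmul a u.1.1, zmul a u.1.2, zmul a u.2).
Definition zvsub (u v : zvec) : zvec := zvadd u (zvscale (zcst (-1)) v).
Definition zdot (u v : zvec) : zphi :=
  zadd (zadd (zmul u.1.1 v.1.1) (zmul u.1.2 v.1.2)) (zmul u.2 v.2).
Definition zcross (u v : zvec) : zvec :=
  (zadd (zmul u.1.2 v.2) (zopp (zmul u.2 v.1.2)),
   zadd (zmul u.2 v.1.1) (zopp (zmul u.1.1 v.2)),
   zadd (zmul u.1.1 v.1.2) (zopp (zmul u.1.2 v.1.1))).
Definition zdet (u v w : zvec) : zphi := zdot u (zcross v w).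
Definition zvm (v : zvec) (M : zmat) : zvec :=
  zvadd (zvadd (zvscale v.1.1 M.1.1) (zvscale v.1.2 M.1.2)) (zvscale v.2 M.2).
Definition zmm (M N : zmat) : zmat := (zvm M.1.1 N, zvm M.1.2 N, zvm M.2 N).
Definition zvdouble (u : zvec) : zvec := zvadd u u.
Definition zmdouble (M : zmat) : zmat := (zvdouble M.1.1, zvdouble M.1.2, zvdouble M.2).
Definition zhalf (x : zphi) : zphi := (Z.div2 x.1, Z.div2 x.2).
Definition zvhalf (v : zvec) : zvec := (zhalf v.1.1, zhalf v.1.2, zhalf v.2).
Definition zmhalf (M : zmat) : zmat := (zvhalf M.1.1, zvhalf M.1.2, zvhalf M.2).
Definition zvcst (a b c : Z) : zvec := (zcst a, zcst b, zcst c).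
Definition zmscalar (k : Z) : zmat := (zvcst k 0 0, zvcst 0 k 0, zvcst 0 0 k).
Definition zmtr (M : zmat) : zmat :=
  ((M.1.1.1.1, M.1.2.1.1, M.2.1.1), (M.1.1.1.2, M.1.2.1.2, M.2.1.2),
   (M.1.1.2, M.1.2.2, M.2.2)).

Definition zgold : zphi := (0, 1)%ZZ.
(** 1 / phi = phi - 1. *)
Definition zgoldV : zphi := (-1, 1)%ZZ.
Definition zsign (e : bool) (x : zphi) : zphi := if e then zopp x else x.

Definition zverts : seq zvec :=
  let signs := [:: false; true] in
  flatten [seq [seq (zsign a (zcst 1), zsign b (zcst 1), zsign c (zcst 1))
                  | b <- signs, c <- signs] | a <- signs] ++
  [seq (zcst 0, zsign a zgoldV, zsign b zgold) | a <- signs, b <- signs] ++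
  [seq (zsign a zgoldV, zsign b zgold, zcst 0) | a <- signs, b <- signs] ++
  [seq (zsign a zgold, zcst 0, zsign b zgoldV) | a <- signs, b <- signs].

(** First [c], then [d], as in the product of [{perm 'I_5}]. *)
Definition ccomp (c d : pcode) : pcode := [seq nth 0 d i | i <- c].

(** Halved, because the product of two doubled matrices is doubled twice. *)
Definition icos_mul (x y : pcode * zmat) : pcode * zmat :=
  (ccomp x.1 y.1, zmhalf (zmm x.2 y.2)).
Definition code1 : pcode := iota 0 5.
Definition icos_one : pcode * zmat := (code1, zmscalar 2).
Definition icos_pow (x : pcode * zmat) n := iter n (icos_mul x) icos_one.
Definition half_turn_x : pcode * zmat :=
  ([:: 3; 2; 1; 0; 4]%N, (zvcst 2 0 0, zvcst 0 (-2) 0, zvcst 0 0 (-2))).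
Definition half_turn_y : pcode * zmat :=
  ([:: 2; 3; 0; 1; 4]%N, (zvcst (-2) 0 0, zvcst 0 2 0, zvcst 0 0 (-2))).
Definition vertex_turn : pcode * zmat :=
  ([:: 2; 1; 3; 0; 4]%N, (zvcst 0 2 0, zvcst 0 0 2, zvcst 2 0 0)).
Definition face_turn : pcode * zmat :=
  ([:: 1; 2; 3; 4; 0]%N,
   (((0,-1), (-1,1), (1,0)), ((1,-1), (1,0), (0,-1)), ((-1,0), (0,-1), (1,-1)))%ZZ).

(** The twelve rotations of the tetrahedral subgroup (a Klein group times a
    group of order 3) are representatives modulo a subgroup of order 5, so each
    of the 60 rotations is obtained exactly once.  The permutation of a rotation
    is its action on the five cubes inscribed in the dodecahedron; number 4 is
    the cube with vertices (+-1, +-1, +-1). *)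
Definition icos_table : seq (pcode * zmat) :=
  let klein := [:: icos_one; half_turn_x; half_turn_y; icos_mul half_turn_x half_turn_y] in
  let tetra := [seq icos_mul x (icos_pow vertex_turn k) | x <- klein, k <- iota 0 3] in
  [seq icos_mul x (icos_pow face_turn k) | x <- tetra, k <- iota 0 5].

Definition codes : seq pcode := Eval vm_compute in unzip1 icos_table.
Definition icos_mats : seq zmat := Eval vm_compute in unzip2 icos_table.
Definition icos_mat (c : pcode) : zmat := nth (zmscalar 2) icos_mats (index c codes).

(** A vertex [zp0] with two of its neighbours [zp1] and [zp2]. *)
Definition zp0 : zvec := zvcst 1 1 1.
Definition zp1 : zvec := (zcst 0, zgoldV, zgold).
Definition zp2 : zvec := (zgoldV, zgold, zcst 0).
Definition zsends (p : zvec) (c : pcode) (q : zvec) := zvm p (icos_mat c) == zvdouble q.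

Lemma size_codes : size codes = 60%N. Proof. by []. Qed.

Lemma codes_uniq : uniq codes. Proof. by vm_compute. Qed.

Lemma icos_mat_uniq : uniq (map icos_mat codes). Proof. by vm_compute. Qed.

Lemma codes_perm : all (fun c => perm_eq c code1) codes. Proof. by vm_compute. Qed.

Lemma icos_mat1 : icos_mat code1 = zmscalar 2. Proof. by []. Qed.

Lemma icos_matM : all (fun c => all (fun d => (ccomp c d \in codes) &&
  (zmm (icos_mat c) (icos_mat d) == zmdouble (icos_mat (ccomp c d)))) codes) codes.
Proof. by vm_compute. Qed.

Lemma icos_matV :
  all (fun c => has (fun d => ccomp c d == code1) codes) codes.
Proof. by vm_compute. Qed.

Lemma icos_mat_rotation : all (fun c => let M := icos_mat c in
  (zmm M (zmtr M) == zmscalar 4) && (zdet M.1.1 M.1.2 M.2 == zcst 8)) codes.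
Proof. by vm_compute. Qed.

Lemma icos_mat_verts : all (fun c => all (fun v =>
  has (zsends v c) zverts) zverts) codes.
Proof. by vm_compute. Qed.

(** A rotation is determined by the images of three linearly independent
    vectors, and it preserves their inner products and their determinant.  Every
    triple of vertices allowed by these constraints is realized in the table. *)
Lemma icos_frames : all (fun q0 => all (fun q1 => all (fun q2 =>
    has (fun c => [&& zsends zp0 c q0, zsends zp1 c q1 & zsends zp2 c q2]) codes)
  [seq q2 <- [seq q2 <- zverts | zdot q0 q2 == zdot zp0 zp2]
     | (zdot q1 q2 == zdot zp1 zp2) && (zdet q0 q1 q2 == zdet zp0 zp1 zp2)])
  [seq q1 <- zverts | zdot q0 q1 == zdot zp0 zp1]) zverts.
Proof. by vm_compute. Qed.

Lemma icos_transitive : all (fun q => has (fun c => zsends zp0 c q) codes) zverts.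
Proof. by vm_compute. Qed.

(** Weights (s, t, x, y) with s + t >= x + y > 0.  If s p + t q = x a + y b for
    four vertices, a functional with maximum m >= 0 on the polytope, attained at
    p and q, is also m at a and b, so [p, q] is not an edge.  The three cases are
    two crossing diagonals of a pentagon, two segments with a common midpoint,
    and two segments with midpoints on one ray from the center, the midpoint of
    [p, q] being the nearer to the center. *)
Definition zcerts : seq (zphi * zphi * zphi * zphi) :=
  let one := zcst 1 in let gold2 := zmul zgold zgold in
  [:: (one, zgold, zgold, one); (one, one, one, one); (gold2, gold2, one, one)].

(** From [zp0], each other vertex is either reached by an edge conjugate to
    [zp0, zp1] or excluded by a certificate. *)
Lemma icos_edges : all (fun q => (zp0 != q) ==>
   has (fun k => let '(s, t, x, y) := k in
     has (fun a => [&& a != zp0, a != q & has (fun b => [&& b != zp0, b != q &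
        zvadd (zvscale s zp0) (zvscale t q) == zvadd (zvscale x a) (zvscale y b)])
       zverts]) zverts) zcerts
   || has (fun c => zsends zp0 c zp0 && zsends zp1 c q) codes) zverts.
Proof. by vm_compute. Qed.

Lemma icos_edge0 : all (fun v => [|| v == zp0, v == zp1 |
  zpos (zdot (zvadd zp0 zp1) (zvsub zp0 v))]) zverts.
Proof. by vm_compute. Qed.

(** Outward normal of the face through [zp0], [zp1] and [zp2]. *)
Definition zn0 : zvec := zcross (zvsub zp2 zp0) (zvsub zp1 zp0).
Definition zface0 : seq zvec := [seq v <- zverts | zdot zn0 (zvsub v zp0) == zcst 0].

Lemma icos_face0 : all (fun v => (v \in zface0) || zpos (zdot zn0 (zvsub zp0 v))) zverts.
Proof. by vm_compute. Qed.

Definition two_sided (n : zvec) : bool :=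
  has (fun v => zpos (zdot n (zvsub v zp0))) zverts &&
  has (fun v => zpos (zdot n (zvsub zp0 v))) zverts.

(** Three noncollinear vertices determine the plane of a face.  For three
    vertices including [zp0], either their plane has vertices strictly on both
    sides or it cuts out a rotated copy of [zface0]. *)
Lemma icos_faces : all (fun q => all (fun r =>
  let n := zcross (zvsub q zp0) (zvsub r zp0) in
  if n == zvcst 0 0 0 then true else if two_sided n then true else
  has (fun c => let f := [seq zvm w (icos_mat c) | w <- zface0] in
    all (fun v => (zdot n (zvsub v zp0) == zcst 0) == (zvdouble v \in f)) zverts) codes)
  zverts) zverts.
Proof. by vm_compute. Qed.

(** * The icosahedral table and the alternating group *)

Section Codes.
Local Open Scope group_scope.
Local Open Scope nat_scope.
Implicit Types (s t : {perm 'I_5}) (c d : pcode).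

Definition code_of s : pcode := [seq val (s i) | i <- enum 'I_5].

Lemma nth_code_of s (i : 'I_5) : nth 0 (code_of s) i = s i.
Proof. by rewrite (nth_map i) ?size_enum_ord // nth_ord_enum. Qed.

Lemma code_of_inj : injective code_of.
Proof. by move=> s t e; apply/permP => i; apply/val_inj; rewrite /= -!nth_code_of e. Qed.

Lemma code_of1 : code_of 1%g = code1.
Proof.
rewrite /code_of (eq_map (g := val)) ?val_enum_ord // => i.
by rewrite perm1.
Qed.

Lemma code_ofM s t : code_of (s * t)%g = ccomp (code_of s) (code_of t).
Proof.
rewrite /ccomp -map_comp; apply: eq_map => i /=.
by rewrite nth_code_of permM.
Qed.

Lemma codes_code_of c : c \in codes -> exists s, code_of s = c.
Proof.
move=> /(allP codes_perm) cP; have cu : uniq c by rewrite (perm_uniq cP) iota_uniq.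
have cs : size c = 5 by rewrite (perm_size cP).
have c5 (i : 'I_5) : nth 0 c i < 5.
  have : nth 0 c i \in c by rewrite mem_nth ?cs.
  by rewrite (perm_mem cP) mem_iota.
have f_inj : injective (fun i : 'I_5 => Ordinal (c5 i)).
  move=> i j [] /eqP; rewrite nth_uniq ?cs // => /eqP; exact: val_inj.
exists (perm f_inj); apply: (@eq_from_nth _ 0); first by rewrite size_map size_enum_ord.
move=> k; rewrite size_map size_enum_ord => k5.
by rewrite -[k]/(val (Ordinal k5)) nth_code_of permE.
Qed.

Definition code_group : {set {perm 'I_5}} := [set s | code_of s \in codes]%SET.

Lemma in_code_group s : (s \in code_group) = (code_of s \in codes).
Proof. exact: finset.in_set. Qed.

Hypothesis codes_mul : forall c d, c \in codes -> d \in codes -> ccomp c d \in codes.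

Lemma code_group_set : group_set code_group.
Proof.
apply/group_setP; split; first by rewrite in_code_group code_of1.
by move=> s t; rewrite !in_code_group code_ofM; apply: codes_mul.
Qed.

Lemma card_code_group : #|code_group| = 60.
Proof.
rewrite cardE -(size_map code_of) -size_codes; apply/perm_size/uniq_perm.
- by rewrite map_inj_uniq ?enum_uniq //; exact: code_of_inj.
- exact: codes_uniq.
move=> c; apply/mapP/idP => [[s + ->]|cC]; first by rewrite mem_enum in_code_group.
by have [s e] := codes_code_of cC; exists s; rewrite // mem_enum in_code_group e.
Qed.

(** A subgroup of order 60 of S_5 has index 2, hence is normal, and it meets the
    simple group A_5 in a normal subgroup of A_5.  That intersection is not
    trivial, since 60 * 60 > 120, so it is A_5. *)
Lemma code_group_Alt : code_group = 'Alt_('I_5) :> {set _}.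
Proof.
pose H := Group code_group_set; pose A := 'Alt_('I_5)%G.
have cS : #|[set: {perm 'I_5}]%SET| = 120 by have := card_Sym 'I_5; rewrite card_ord.
have cA : #|A| = 60.
  by have := @card_Alt 'I_5; rewrite card_ord => /(_ isT) /eqP;
    rewrite (_ : 5`! = 2 * 60) // eqn_pmul2l // => /eqP.
have cH : #|H| = 60 := card_code_group.
have iH : #|[set: {perm 'I_5}]%G : H| = 2 by rewrite -divgS ?finset.subsetT //= cS cH.
have nH := index2_normal (finset.subsetT _) iH.
have nK : normal (H :&: A)%g A.
  rewrite /normal finset.subsetIr normsI ?normG //.
  exact: fintype.subset_trans (finset.subsetT _) (normal_norm nH).
have /simpleP[_ /(_ _ nK)] : simple A by apply: simple_Alt5; rewrite card_ord.
case=> [K1|KA].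
  have := mul_cardG H A; rewrite cH cA K1 cards1 muln1 => e.
  have : #|(H * A)%g| <= 120 by rewrite -cS; apply/subset_leq_card/finset.subsetT.
  by rewrite -e.
apply/esym/eqP; rewrite eqEcard /= cA cH leqnn andbT.
by apply/fintype.subsetP => s; rewrite -{1}KA finset.in_setI => /andP[].
Qed.

End Codes.

Local Open Scope ring_scope.

(** * Linear fractional maps in homogeneous coordinates *)

Section Mat2.
Variable K : comNzRingType.
Implicit Types (M N : 'M[K]_2) (v w : 'cV[K]_2).

Lemma forall_ord2 (P : 'I_2 -> Prop) : P 0 -> P 1 -> forall i, P i.
Proof.
move=> P0 P1; case=> [[|[|//]]] lt_i.
  by rewrite (_ : Ordinal lt_i = 0) //; apply/val_inj.
by rewrite (_ : Ordinal lt_i = 1) //; apply/val_inj.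
Qed.

Lemma sum_ord2 (F : 'I_2 -> K) : \sum_i F i = F 0 + F 1.
Proof. by rewrite big_ord_recl big_ord1; congr (_ + F _); apply/val_inj. Qed.

Lemma det_mx2E M : \det M = M 0 0 * M 1 1 - M 0 1 * M 1 0.
Proof.
rewrite (expand_det_row _ 0) sum_ord2 /cofactor !det_mx11 !mxE /=.
have -> : lift (0 : 'I_2) 0 = 1 by apply/val_inj.
have -> : lift (1 : 'I_2) 0 = 0 by apply/val_inj.
by rewrite expr0 expr1; ring.
Qed.

Lemma eq_col2 v w : v 0 0 = w 0 0 -> v 1 0 = w 1 0 -> v = w.
Proof. by move=> e0 e1; apply/matrixP=> i j; rewrite !ord1; elim/forall_ord2: i. Qed.

Lemma mulmx_col2E M v i : (M *m v) i 0 = M i 0 * v 0 0 + M i 1 * v 1 0.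
Proof. by rewrite mxE sum_ord2. Qed.

Lemma eq_mx2 M N :
  M 0 0 = N 0 0 -> M 0 1 = N 0 1 -> M 1 0 = N 1 0 -> M 1 1 = N 1 1 -> M = N.
Proof.
by move=> ? ? ? ?; apply/matrixP; elim/forall_ord2; elim/forall_ord2.
Qed.
End Mat2.

Section Projective.
Variable R : realType.
Local Notation C := R[i].
Implicit Types (M N : 'M[C]_2) (z t : extC R).

(** Homogeneous coordinates of a point of the Riemann sphere; the point at
    infinity is [1 : 0]. *)
Definition hvec z : 'cV[C]_2 :=
  if z is Some w then \col_i [:: w; 1]`_i else \col_i [:: 1; 0]`_i.

Arguments hvec : simpl never.

Lemma hvecE z : (hvec z 0 0 = if z is Some w then w else 1) *
                (hvec z 1 0 = if z is Some w then 1 else 0).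
Proof. by case: z => [w|]; rewrite /hvec !mxE. Qed.

Lemma hvec_inj z t k : k != 0 -> hvec z = k *: hvec t -> z = t.
Proof.
move=> k0 /matrixP e; move: (e 0 0) (e 1 0); rewrite !mxE !hvecE.
case: z t e => [w|] [w'|] // e.
- by move=> -> /eqP; rewrite mulr1 eq_sym => /eqP ->; rewrite mul1r.
- by move=> _ /eqP; rewrite mulr0 oner_eq0.
- by move=> _ /eqP; rewrite mulr1 eq_sym (negbTE k0).
Qed.

(** Matrix multiplication represents the linear fractional map up to a scalar,
    which removes the case distinctions on the point at infinity. *)
Lemma lf_hvec M z : \det M != 0 ->
  exists2 k, k != 0 & M *m hvec z = k *: hvec (linear_fractional M z).
Proof.
rewrite det_mx2E => dM; case: z => [w|] /=; case: eqP => [e0|/eqP ne0].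
- exists (M 0 0 * w + M 0 1).
    apply: contraNneq dM => e1.
    have [M00|M00] := eqVneq (M 0 0) 0.
      have [M10|M10] := eqVneq (M 1 0) 0; first by rewrite M00 M10; apply/eqP; ring.
      by move: e1; rewrite M00 mul0r add0r => ->; rewrite !mul0r subr0.
    rewrite -(inj_eq (mulfI M00)) mulr0; apply/eqP.
    have -> : M 0 1 = - (M 0 0 * w) by apply/eqP; rewrite -addr_eq0 addrC e1.
    have -> : M 1 1 = - (M 1 0 * w) by apply/eqP; rewrite -addr_eq0 addrC e0.
    by ring.
  apply: eq_col2; rewrite mulmx_col2E [RHS]mxE !hvecE ?mulr1 ?mulr0 //.
- exists (M 1 0 * w + M 1 1) => //.
  by apply: eq_col2; rewrite mulmx_col2E [RHS]mxE !hvecE ?mulr1 // [RHS]mulrC divfK.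
- exists (M 0 0); first by apply: contraNneq dM => ->; rewrite e0 mulr0 mul0r subrr.
  by apply: eq_col2; rewrite mulmx_col2E [RHS]mxE !hvecE ?mulr1 ?mulr0 ?addr0.
- exists (M 1 0) => //.
  by apply: eq_col2; rewrite mulmx_col2E [RHS]mxE !hvecE ?mulr1 ?mulr0 ?addr0 // [RHS]mulrC divfK.
Qed.

Lemma lf_unique M z t k : \det M != 0 -> k != 0 ->
  M *m hvec z = k *: hvec t -> linear_fractional M z = t.
Proof.
move=> dM k0 e; have [l l0] := lf_hvec z dM; rewrite e => e'.
apply: (@hvec_inj _ _ (l^-1 * k)); first by rewrite mulf_neq0 ?invr_eq0.
by rewrite -scalerA e' scalerA mulVf ?scale1r.
Qed.

Lemma lf_mul M N z : \det M != 0 -> \det N != 0 ->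
  linear_fractional M (linear_fractional N z) = linear_fractional (M *m N) z.
Proof.
move=> dM dN; have [k k0 eN] := lf_hvec z dN.
have [l l0 eM] := lf_hvec (linear_fractional N z) dM.
apply/esym/(@lf_unique _ _ _ (k * l)); rewrite ?det_mulmx ?mulf_neq0 //.
by rewrite -mulmxA eN -scalemxAr eM scalerA.
Qed.

Lemma lf_scalar a z : a != 0 -> linear_fractional (a%:M) z = z.
Proof.
move=> a0; apply: (@lf_unique _ _ _ a) => //.
  by rewrite det_scalar expf_neq0.
by rewrite mul_scalar_mx.
Qed.

(** The quadratic form whose zeros are the fixed points of [M]: the determinant
    of the pair (x, M x). *)
Definition fix_form M z : C :=
  M 1 0 * hvec z 0 0 ^+ 2 + (M 1 1 - M 0 0) * hvec z 0 0 * hvec z 1 0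
  - M 0 1 * hvec z 1 0 ^+ 2.

Lemma lf_fixP M z : \det M != 0 ->
  linear_fractional M z = z <-> fix_form M z = 0.
Proof.
move=> dM; split=> [fz|].
  have [k _] := lf_hvec z dM; rewrite fz => /matrixP e.
  have := (e 0 0, e 1 0); rewrite !mulmx_col2E !mxE /fix_form.
  move: (hvec z 0 0) (hvec z 1 0) => x y [e0 e1].
  rewrite [LHS](_ : _ = x * (M 1 0 * x + M 1 1 * y) - y * (M 0 0 * x + M 0 1 * y)).
    by rewrite e0 e1; ring.
  by ring.
rewrite /fix_form !hvecE; case: z => [w|] /=; last first.
  rewrite !expr2 !(mulr0, mulr1, addr0, subr0) => ->.
  by rewrite eqxx.
rewrite !expr2 !mulr1 => e.
have e' : w * (M 1 0 * w + M 1 1) = M 0 0 * w + M 0 1.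
  by apply/eqP; rewrite -subr_eq0 -[X in _ == X]e; apply/eqP; ring.
case: eqP => [e0|/eqP ne0]; last by rewrite -e' mulfK.
case/eqP: dM; rewrite det_mx2E.
move: e'; rewrite e0 mulr0 => /esym e1.
have -> : M 0 1 = - (M 0 0 * w) by apply/eqP; rewrite -addr_eq0 addrC e1.
have -> : M 1 1 = - (M 1 0 * w) by apply/eqP; rewrite -addr_eq0 addrC e0.
by ring.
Qed.

(** A nonzero binary quadratic form has at most two zeros on the projective
    line. *)
Lemma fix_form3 M z1 z2 z3 : z1 != z2 -> z1 != z3 -> z2 != z3 ->
  fix_form M z1 = 0 -> fix_form M z2 = 0 -> fix_form M z3 = 0 ->
  M = (M 0 0)%:M.
Proof.
move=> n12 n13 n23; rewrite /fix_form !hvecE.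
have scal : M 1 0 = 0 -> M 0 1 = 0 -> M 1 1 = M 0 0 -> M = (M 0 0)%:M.
  by move=> *; apply: eq_mx2; rewrite !mxE.
(* with the point at infinity fixed, the form is affine on finite points *)
have main2 w1 w2 : w1 != w2 -> M 1 0 = 0 ->
  (M 1 1 - M 0 0) * w1 = M 0 1 -> (M 1 1 - M 0 0) * w2 = M 0 1 -> M = (M 0 0)%:M.
  move=> n M10 e1 e2.
  have d0 : M 1 1 - M 0 0 = 0.
    apply/eqP; move: n; rewrite -subr_eq0 => n; rewrite -(mulIr_eq0 _ (mulIf n)).
    by rewrite mulrBr e1 e2 subrr.
  by apply: scal => //; [rewrite -e1 d0 mul0r | apply/eqP; rewrite -subr_eq0 d0].
case: z1 z2 z3 n12 n13 n23 => [w1|] [w2|] [w3|] //=; rewrite ?expr2 ?mulr1 ?mulr0 ?addr0 ?subr0.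
- have neS (a b : C) : Some a != Some b -> a - b != 0.
    by rewrite subr_eq0; apply: contraNneq => ->.
  move=> /neS n12 /neS n13 /neS n23 e1 e2 e3.
  set a := M 1 0 in e1 e2 e3 *; set b := M 1 1 - M 0 0 in e1 e2 e3; set c := M 0 1 in e1 e2 e3 *.
  have e12 : a * (w1 + w2) + b = 0.
    by apply/eqP; rewrite -(mulIr_eq0 _ (mulIf n12)); apply/eqP;
      rewrite -[RHS](subrr (0 : C)) -{1}e1 -e2; ring.
  have e13 : a * (w1 + w3) + b = 0.
    by apply/eqP; rewrite -(mulIr_eq0 _ (mulIf n13)); apply/eqP;
      rewrite -[RHS](subrr (0 : C)) -{1}e1 -e3; ring.
  have a0 : a = 0.
    by apply/eqP; rewrite -(mulIr_eq0 _ (mulIf n23)); apply/eqP;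
      rewrite -[RHS](subrr (0 : C)) -{1}e12 -e13; ring.
  have b0 : b = 0 by move: e12; rewrite a0 mul0r add0r.
  have c0 : c = 0 by apply/eqP; move: e1; rewrite a0 b0 !mul0r !add0r => /eqP; rewrite oppr_eq0.
  by apply: scal => //; apply/eqP; rewrite -subr_eq0 -/b b0.
- move=> n12 _ _ e1 e2 e3; apply: (@main2 w1 w2) => //.
  + by apply/eqP; rewrite -subr_eq0; move: e1; rewrite e3 !mul0r add0r => ->.
  + by apply/eqP; rewrite -subr_eq0; move: e2; rewrite e3 !mul0r add0r => ->.
- move=> _ n13 _ e1 e3 e2; apply: (@main2 w1 w3) => //.
  + by apply/eqP; rewrite -subr_eq0; move: e1; rewrite e3 !mul0r add0r => ->.
  + by apply/eqP; rewrite -subr_eq0; move: e2; rewrite e3 !mul0r add0r => ->.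
- move=> _ _ n23 e3 e1 e2; apply: (@main2 w2 w3) => //.
  + by apply/eqP; rewrite -subr_eq0; move: e1; rewrite e3 !mul0r add0r => ->.
  + by apply/eqP; rewrite -subr_eq0; move: e2; rewrite e3 !mul0r add0r => ->.
Qed.

(** Discriminant of [fix_form M], also that of the characteristic polynomial. *)
Definition disc M : C := (M 1 1 - M 0 0) ^+ 2 + 4 * M 0 1 * M 1 0.

(** A matrix with a double eigenvalue t is t + N with N^2 = 0, so its m-th power
    is t^m + m t^(m-1) N, which in characteristic 0 is scalar only for N = 0:
    parabolic maps have infinite order. *)
Lemma disc0_torsion M m : \det M != 0 -> disc M = 0 -> (0 < m)%N ->
  (exists a, M ^+ m = a%:M) -> M = (M 0 0)%:M.
Proof.
move=> dM d0; case: m => // m _ [a].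
pose t := (M 0 0 + M 1 1) / 2; pose N : 'M[C]_2 := M - t%:M.
have two0 : (2 : C) != 0 by rewrite pnatr_eq0.
have NE i j : N i j = M i j - t *+ (i == j) by rewrite !mxE.
have NN : N *m N = 0.
  by move: d0; rewrite /disc => d0; apply: eq_mx2;
    rewrite !mxE sum_ord2 !NE /= ?mulr0n ?mulr1n ?subr0 /t;
   [ rewrite -[RHS](mul0r (4^-1)) -d0 | | | rewrite -[RHS](mul0r (4^-1)) -d0 ]; field;
     rewrite ?two0.
have MN : M = t%:M + N by rewrite addrC subrK.
clearbody N.
have powM k : M ^+ k.+1 = (t ^+ k.+1)%:M + (k.+1%:R * t ^+ k) *: N.
  elim: k => [|k IH]; first by rewrite !expr1 expr0 mulr1 scale1r.
  rewrite exprS IH {1}MN -mulmxE mulmxDl !mulmxDr -scalar_mxM -exprS.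
  rewrite -!scalemxAr NN scaler0 addr0 !mul_scalar_mx mul_mx_scalar scalerA -addrA -scalerDl.
  by congr (_ + _ *: _); rewrite [k.+2%:R]mulrS exprS; ring.
have t0 : t != 0.
  apply: contraNneq dM => t0; rewrite det_mx2E.
  have := d0; rewrite /disc => d0'.
  have e : M 1 1 = - M 0 0.
    apply/eqP; rewrite -addr_eq0 addrC; move: t0 => /eqP.
    by rewrite mulf_eq0 invr_eq0 (negbTE two0) orbF.
  apply/eqP; apply: (mulfI (_ : (-4 : C) != 0)); first by rewrite oppr_eq0 pnatr_eq0.
  by rewrite mulr0 -d0' e; ring.
rewrite powM => e.
have k0 : m.+1%:R * t ^+ m != 0 by rewrite mulf_neq0 ?expf_neq0 ?pnatr_eq0.
have {}e : N = ((m.+1%:R * t ^+ m)^-1 * (a - t ^+ m.+1))%:M.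
  by apply: (scalerI k0); rewrite scale_scalar_mx mulVKf // [RHS]raddfB /= -e addrC addKr.
set b := (_ * _) in e.
have eM : M = (t + b)%:M by rewrite {1}MN e -raddfD.
by rewrite eM mxE.
Qed.

Lemma two_fix_form M : disc M != 0 ->
  exists z t, [/\ z != t, fix_form M z = 0 & fix_form M t = 0].
Proof.
have two0 : (2 : C) != 0 by rewrite pnatr_eq0.
rewrite /disc => d0; have [M10|M10] := eqVneq (M 1 0) 0.
  have n : M 1 1 - M 0 0 != 0 by move: d0; rewrite M10 mulr0 addr0 expf_eq0.
  exists None, (Some (M 0 1 / (M 1 1 - M 0 0))); split=> //.
    by rewrite /fix_form !hvecE M10 !expr2 !(mulr0, mul0r, addr0, subr0).
  by rewrite /fix_form !hvecE M10 expr1n mul0r add0r !mulr1 mulrC divfK ?subrr.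
set s := sqrtC ((M 1 1 - M 0 0) ^+ 2 + 4 * M 0 1 * M 1 0).
have s2 : s ^+ 2 = (M 1 1 - M 0 0) ^+ 2 + 4 * M 0 1 * M 1 0 by rewrite sqrtCK.
have s0 : s != 0 by rewrite sqrtC_eq0.
have root e : e ^+ 2 = 1 -> fix_form M (Some ((M 0 0 - M 1 1 + e * s) / (2 * M 1 0))) = 0.
  move=> e2; rewrite /fix_form !hvecE; apply: (mulfI (_ : 4 * M 1 0 != 0)).
    by rewrite mulf_neq0 ?pnatr_eq0.
  rewrite mulr0; transitivity (e ^+ 2 * s ^+ 2 - ((M 1 1 - M 0 0) ^+ 2 + 4 * M 0 1 * M 1 0)).
    by field.
  by rewrite e2 s2 mul1r subrr.
exists (Some ((M 0 0 - M 1 1 + 1 * s) / (2 * M 1 0))), (Some ((M 0 0 - M 1 1 +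
  -1 * s) / (2 * M 1 0))).
split; [|by apply: root; rewrite expr1n|by apply: root; rewrite sqrrN expr1n].
apply: contra_neq s0 => -[] /(mulIf (_ : (2 * M 1 0)^-1 != 0)).
rewrite invr_eq0 mulf_neq0 // => /(_ isT) /addrI e.
apply/eqP; rewrite -(mulrI_eq0 _ (mulfI two0)); apply/eqP.
by rewrite mulr_natl mulr2n -{1}[s]mul1r e mulN1r addNr.
Qed.

End Projective.

(** * Stereographic projection *)

Section Dim3.
Variable R : realType.
Implicit Types (u v w : 'rV[R]_3) (P : 'M[R]_3) (x y : sphere R).

Lemma forall_ord3 (Pr : 'I_3 -> Prop) : Pr 0 -> Pr 1 -> Pr 2 -> forall i, Pr i.
Proof.
move=> P0 P1 P2; case=> [[|[|[|//]]]] lt_i.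
- by rewrite (_ : Ordinal lt_i = 0) //; apply/val_inj.
- by rewrite (_ : Ordinal lt_i = 1) //; apply/val_inj.
- by rewrite (_ : Ordinal lt_i = 2) //; apply/val_inj.
Qed.

Lemma sum_ord3 (V : nmodType) (F : 'I_3 -> V) : \sum_i F i = F 0 + F 1 + F 2.
Proof.
rewrite !big_ord_recl big_ord0 addr0 addrA.
by congr (_ + F _ + F _); apply/val_inj.
Qed.

Lemma vec3E (a b c : R) :
  (vec3 a b c 0 0 = a) * (vec3 a b c 0 1 = b) * (vec3 a b c 0 2 = c).
Proof. by rewrite /vec3 !mxE. Qed.

Lemma eq_vec3 u v : u 0 0 = v 0 0 -> u 0 1 = v 0 1 -> u 0 2 = v 0 2 -> u = v.
Proof. by move=> *; apply/matrixP=> i; rewrite ord1; elim/forall_ord3. Qed.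

Lemma dotvE u v : dotv u v = u 0 0 * v 0 0 + u 0 1 * v 0 1 + u 0 2 * v 0 2.
Proof. by rewrite /dotv mxE sum_ord3 !mxE. Qed.

Lemma dotv_gt0 u : u != 0 -> 0 < dotv u u.
Proof.
move=> u0; rewrite lt_def; apply/andP; split; last by rewrite dotvE; nra.
apply: contraNneq u0; rewrite dotvE => e; apply/eqP.
have h : (u 0 0) ^+ 2 = 0 /\ (u 0 1) ^+ 2 = 0 /\ (u 0 2) ^+ 2 = 0.
  by do !split; nra.
case: h => /eqP; rewrite sqrf_eq0 => /eqP e0 [/eqP]; rewrite sqrf_eq0 => /eqP e1.
move=> /eqP; rewrite sqrf_eq0 => /eqP e2.
by apply: eq_vec3; rewrite mxE.
Qed.

Lemma sphere_inj : injective (@sphere_val R).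
Proof.
case=> u hu [v hv] /= e; move: hv; rewrite -e => hv; congr Sphere.
exact: bool_irrelevance.
Qed.

Lemma sphereE x :
  sphere_val x 0 0 ^+ 2 + sphere_val x 0 1 ^+ 2 + sphere_val x 0 2 ^+ 2 = 1.
Proof. by have /eqP := sphere_valP x; rewrite dotvE -!expr2. Qed.

End Dim3.

Section Stereo.
Variable R : realType.
Local Notation C := R[i].
Implicit Types (u v w : 'rV[R]_3) (P : 'M[R]_3) (x y : sphere R) (z : extC R).

(** The Pauli matrix of [u], a traceless Hermitian matrix with square |u|^2. *)
Definition spin u : 'M[C]_2 :=
  \matrix_(i < 2, j < 2)
    (if i == 0 then if j == 0 then u 0 2 +i* 0 else u 0 0 +i* u 0 1
     else if j == 0 then u 0 0 -i* u 0 1 else - u 0 2 +i* 0)%C.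

Lemma spinE u : (spin u 0 0 = (u 0 2 +i* 0)%C) * (spin u 0 1 = (u 0 0 +i* u 0 1)%C) *
   (spin u 1 0 = (u 0 0 -i* u 0 1)%C) * (spin u 1 1 = (- u 0 2 +i* 0)%C).
Proof. by rewrite !mxE. Qed.

(** For a unit vector x, [spin x] is an involution with eigenvalues 1 and -1, and
    its fixed line is the point of the projective line that corresponds to x.
    This turns stereographic projection into a linear condition. *)
Lemma stereoP x z : stereo x = z <-> spin (sphere_val x) *m hvec z = hvec z.
Proof.
have := sphereE x; rewrite /stereo.
set a := sphere_val x 0 0; set b := sphere_val x 0 1; set c := sphere_val x 0 2.
move=> n1; split.
  case: eqP => [c1|/eqP c1] <-.
    have /eqP : a ^+ 2 + b ^+ 2 = 0 by move: n1; rewrite c1; lra.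
    rewrite paddr_eq0 ?sqr_ge0 // !sqrf_eq0 => /andP[/eqP a0 /eqP b0].
    apply: eq_col2; rewrite mulmx_col2E !hvecE !spinE !mulr1 !mulr0 !addr0 -/a -/b -/c.
      by rewrite c1.
    by rewrite a0 b0 oppr0.
  have d0 : 1 - c != 0 by rewrite subr_eq0 eq_sym.
  apply: eq_col2; rewrite mulmx_col2E !hvecE !spinE -/a -/b -/c mulr1;
    apply/eqP; rewrite eq_complex /=; apply/andP; split; apply/eqP.
  - by field.
  - by field.
  - have -> : a * (a / (1 - c)) - (- b) * (b / (1 - c)) + - c = (a ^+ 2 + b ^+ 2) / (1 - c) -
    c by field.
    by rewrite (_ : a ^+ 2 + b ^+ 2 = (1 - c) * (1 + c)); [field | lra].
  - by field.
move=> /matrixP e; have := (e 0 0, e 1 0); rewrite !mulmx_col2E !hvecE !spinE -/a -/b -/c.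
case: z {e} => [[p q]|] [/eqP + /eqP];
  rewrite !eq_complex /= ?(mulr1, mulr0, mul0r, addr0, subr0, oppr0);
  last by move=> /andP[/eqP -> _]; rewrite eqxx.
move=> /andP[/eqP e1 /eqP e2] /andP[/eqP e3 /eqP e4].
case: eqP => [c1|/eqP c1].
  have /eqP : a ^+ 2 + b ^+ 2 = 0 by move: n1; rewrite c1; lra.
  rewrite paddr_eq0 ?sqr_ge0 // !sqrf_eq0 => /andP[/eqP a0 /eqP b0].
  by exfalso; move: e3; rewrite a0 b0 c1; lra.
have d0 : 1 - c != 0 by rewrite subr_eq0 eq_sym.
congr Some; apply/eqP; rewrite eq_complex /=; apply/andP; split; apply/eqP; apply: (mulIf d0).
- by rewrite divfK //; lra.
- by rewrite divfK //; lra.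
Qed.

(** The inverse of stereographic projection from the north pole. *)
Definition unstereo_vec z : 'rV[R]_3 :=
  if z is Some (p +i* q)%C then
    let r := p ^+ 2 + q ^+ 2 in
    vec3 (2 * p / (r + 1)) (2 * q / (r + 1)) ((r - 1) / (r + 1))
  else vec3 0 0 1.

Lemma sqr2D1_neq0 (p q : R) : p ^+ 2 + q ^+ 2 + 1 != 0.
Proof. by rewrite gt_eqF //; nra. Qed.

Lemma unstereo_subproof z : dotv (unstereo_vec z) (unstereo_vec z) == 1.
Proof.
rewrite dotvE; case: z => [[p q]|]; rewrite /= !vec3E; apply/eqP.
  by field; exact: sqr2D1_neq0.
by rewrite !mulr0 !add0r mulr1.
Qed.

Definition unstereo z : sphere R := Sphere (unstereo_subproof z).

Lemma unstereoK : cancel unstereo (@stereo R).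
Proof.
move=> z; apply/stereoP; rewrite /= ; apply: eq_col2; rewrite mulmx_col2E !spinE !hvecE;
case: z => [[p q]|]; rewrite /= !vec3E ?(mulr1, mulr0, addr0, oppr0) //;
  apply/eqP; rewrite eq_complex /=; apply/andP; split; apply/eqP; field; exact: sqr2D1_neq0.
Qed.

Lemma stereo_inj : injective (@stereo R).
Proof.
suff h x : sphere_val x = unstereo_vec (stereo x).
  by move=> x y e; apply: sphere_inj; rewrite !h e.
have [z ez] : exists z, stereo x = z by exists (stereo x).
rewrite ez; move/stereoP: ez (sphereE x).
set a := sphere_val x 0 0; set b := sphere_val x 0 1; set c := sphere_val x 0 2.
move=> /matrixP e n1; have := (e 0 0, e 1 0); rewrite !mulmx_col2E !hvecE !spinE -/a -/b -/c.
case: z {e} => [[p q]|] [/eqP + /eqP];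
  rewrite !eq_complex /= ?(mulr1, mulr0, mul0r, addr0, subr0, oppr0).
  move=> /andP[/eqP e1 /eqP e2] /andP[/eqP e3 /eqP e4].
  have r0 := sqr2D1_neq0 p q.
  have ec : c = (p ^+ 2 + q ^+ 2 - 1) / (p ^+ 2 + q ^+ 2 + 1).
    apply: (mulIf r0); rewrite divfK //.
    have ea : a = p * (1 - c) by lra.
    have eb : b = q * (1 - c) by lra.
    by move: e3; rewrite ea eb; nra.
  apply: eq_vec3; rewrite vec3E -/a -/b -/c //.
    by rewrite (_ : a = p * (1 - c)); [rewrite ec; field | lra].
  by rewrite (_ : b = q * (1 - c)); [rewrite ec; field | lra].
move=> /andP[/eqP c1 _] /andP[/eqP a0 /eqP b0].
by apply: eq_vec3; rewrite vec3E -/a -/b -/c //; lra.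
Qed.

Lemma stereoK : cancel (@stereo R) unstereo.
Proof. by move=> x; apply: stereo_inj; rewrite unstereoK. Qed.

Lemma is_lft_id : is_lft (@id (sphere R)).
Proof. by exists 1%:M => [|x]; rewrite ?det1 ?oner_eq0 // lf_scalar ?oner_eq0. Qed.

Lemma is_lft_comp (g h : sphere R -> sphere R) : is_lft g -> is_lft h -> is_lft (g \o h).
Proof.
move=> [M dM eM] [N dN eN]; exists (M *m N) => [|x].
  by rewrite det_mulmx mulf_neq0.
by rewrite /= eM eN lf_mul.
Qed.

Lemma is_lft_unstereo (M : 'M[C]_2) : \det M != 0 ->
  is_lft (unstereo \o linear_fractional M \o @stereo R).
Proof. by move=> dM; exists M => // x /=; rewrite unstereoK. Qed.

Lemma is_lft_inv (h : sphere R -> sphere R) : is_lft h ->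
  exists g, [/\ is_lft g, cancel h g & cancel g h].
Proof.
move=> [M dM eM]; exists (unstereo \o linear_fractional (invmx M) \o @stereo R).
have uM : M \in unitmx by rewrite unitmxE unitfE.
have dV : \det (invmx M) != 0 by rewrite det_inv invr_eq0.
split; first exact: is_lft_unstereo.
  by move=> x /=; rewrite eM lf_mul // mulVmx // lf_scalar ?oner_eq0 // stereoK.
move=> x /=; apply: stereo_inj.
by rewrite eM unstereoK lf_mul // mulmxV // lf_scalar ?oner_eq0.
Qed.

(** Three fixed points are three zeros of [fix_form], which forces a scalar
    matrix. *)
Lemma is_lft_fix3 (h : sphere R -> sphere R) x y t : is_lft h ->
  x <> y -> x <> t -> y <> t -> h x = x -> h y = y -> h t = t -> h = id.
Proof.
move=> [M dM eM] nxy nxt nyt hx hy ht.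
have ne (p q : sphere R) : p <> q -> stereo p != stereo q.
  by move=> n; apply/eqP => /stereo_inj.
have fx p : h p = p -> fix_form M (stereo p) = 0 by move=> hp; apply/lf_fixP => //; rewrite -eM hp.
have e := fix_form3 (ne _ _ nxy) (ne _ _ nxt) (ne _ _ nyt) (fx _ hx) (fx _ hy) (fx _ ht).
apply/funext=> p; apply: stereo_inj; rewrite eM e lf_scalar //.
by apply: contraNneq dM => M00; rewrite e M00 det_scalar expr2 mul0r.
Qed.

Lemma det_expr_neq0 (M : 'M[C]_2) m : \det M != 0 -> \det (M ^+ m) != 0.
Proof.
move=> dM; elim: m => [|m IH]; first by rewrite expr0 det1 oner_eq0.
by rewrite exprS -mulmxE det_mulmx mulf_neq0.
Qed.

Lemma is_lft_iter (h : sphere R -> sphere R) (M : 'M[C]_2) m : \det M != 0 ->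
  (forall x, stereo (h x) = linear_fractional M (stereo x)) ->
  forall x, stereo (iter m h x) = linear_fractional (M ^+ m) (stereo x).
Proof.
move=> dM eM; elim: m => [|m IH] x; first by rewrite expr0 lf_scalar ?oner_eq0.
by rewrite iterS eM IH lf_mul ?det_expr_neq0 // exprS mulmxE.
Qed.

(** Finite order excludes the parabolic case, so the fixed point form has two
    distinct zeros. *)
Lemma is_lft_two_fixed (h : sphere R -> sphere R) m : is_lft h -> h <> id ->
  (0 < m)%N -> iter m h =1 id ->
  exists x y, x <> y /\ forall t, h t = t <-> t = x \/ t = y.
Proof.
move=> lh nh m0 hm; have [M dM eM] := lh.
have Mns : M <> (M 0 0)%:M.
  move=> e; apply: nh; apply/funext=> p; apply: stereo_inj; rewrite eM e lf_scalar //.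
  by apply: contraNneq dM => M00; rewrite e M00 det_scalar expr2 mul0r.
have dn : disc M != 0.
  apply/eqP=> d0; apply: Mns; apply: (disc0_torsion dM d0 m0).
  exists ((M ^+ m) 0 0).
  have dMm := det_expr_neq0 m dM.
  have fx z : fix_form (M ^+ m) z = 0.
    by apply/lf_fixP => //; rewrite -[z]unstereoK -(is_lft_iter _ dM eM) hm.
  by apply: (@fix_form3 _ _ (Some 0) (Some 1) None) => //; apply/eqP => -[] /eqP;
    rewrite eq_sym oner_eq0.
have [z [t [nzt fz ft]]] := two_fix_form dn.
have hz : h (unstereo z) = unstereo z.
  by apply: stereo_inj; rewrite eM unstereoK; apply/lf_fixP.
have ht : h (unstereo t) = unstereo t.
  by apply: stereo_inj; rewrite eM unstereoK; apply/lf_fixP.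
have nu : unstereo z <> unstereo t.
  by move=> /(congr1 (@stereo R)); rewrite !unstereoK; apply/eqP.
exists (unstereo z), (unstereo t); split=> // p; split=> [hp|[->|->]] //.
apply: contrapT => /not_orP[n1 n2]; apply: nh.
by apply: (is_lft_fix3 lh nu _ _ hz ht hp) => e; [apply: n1|apply: n2].
Qed.

End Stereo.

(** * Rotations are linear fractional *)

Section Rotation.
Variable R : realType.
Local Notation C := R[i].
Implicit Types (u v w : 'rV[R]_3) (P Q : 'M[R]_3) (M : 'M[C]_2) (x y : sphere R).

Definition rotation_mx P := orthogonal_mx P /\ \det P = 1.

Lemma det_mx3E (K : comNzRingType) (A : 'M[K]_3) :
  \det A = A 0 0 * (A 1 1 * A 2 2 - A 1 2 * A 2 1)
         - A 0 1 * (A 1 0 * A 2 2 - A 1 2 * A 2 0)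
         + A 0 2 * (A 1 0 * A 2 1 - A 1 1 * A 2 0).
Proof.
rewrite (expand_det_row _ 0) sum_ord3 /cofactor !det_mx2E !mxE /=.
have l00 : lift (0 : 'I_3) (0 : 'I_2) = 1 by apply/val_inj.
have l01 : lift (0 : 'I_3) (1 : 'I_2) = 2 by apply/val_inj.
have l10 : lift (1 : 'I_3) (0 : 'I_2) = 0 by apply/val_inj.
have l11 : lift (1 : 'I_3) (1 : 'I_2) = 2 by apply/val_inj.
have l20 : lift (2 : 'I_3) (0 : 'I_2) = 0 by apply/val_inj.
have l21 : lift (2 : 'I_3) (1 : 'I_2) = 1 by apply/val_inj.
by rewrite !l00 !l01 !l10 !l11 !l20 !l21 expr0 expr1 expr2; ring.
Qed.

Lemma mulmx_row3E u P j :
  (u *m P) 0 j = u 0 0 * P 0 j + u 0 1 * P 1 j + u 0 2 * P 2 j.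
Proof. by rewrite mxE sum_ord3. Qed.

Lemma orthogonal_dotv P u v : orthogonal_mx P -> dotv (u *m P) (v *m P) = dotv u v.
Proof. by move=> oP; rewrite /dotv trmx_mul mulmxA -(mulmxA u) oP mulmx1. Qed.

Lemma orthogonal_mxC P : orthogonal_mx P -> P^T *m P = 1%:M.
Proof. exact: mulmx1C. Qed.

Lemma orthogonal_mxT P : orthogonal_mx P -> orthogonal_mx P^T.
Proof. by move=> oP; rewrite /orthogonal_mx trmxK orthogonal_mxC. Qed.

Lemma orthogonal_mxM P Q : orthogonal_mx P -> orthogonal_mx Q -> orthogonal_mx (P *m Q).
Proof.
by move=> oP oQ; rewrite /orthogonal_mx trmx_mul mulmxA -(mulmxA P) oQ mulmx1.
Qed.

Lemma orthogonal_mulmxK P u : orthogonal_mx P -> u *m P *m P^T = u.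
Proof. by move=> oP; rewrite -mulmxA oP mulmx1. Qed.

Lemma orthogonal_mulmxKV P u : orthogonal_mx P -> u *m P^T *m P = u.
Proof. by move=> /orthogonal_mxC oP; rewrite -mulmxA oP mulmx1. Qed.

Lemma rotation_mxM P Q : rotation_mx P -> rotation_mx Q -> rotation_mx (P *m Q).
Proof.
move=> [oP dP] [oQ dQ]; split; first exact: orthogonal_mxM.
by rewrite det_mulmx dP dQ mulr1.
Qed.

Lemma rotation_conj P Q : orthogonal_mx Q -> rotation_mx P -> rotation_mx (Q *m P *m Q^T).
Proof.
move=> oQ [oP dP]; split; first by do !apply: orthogonal_mxM => //; apply: orthogonal_mxT.
by rewrite !det_mulmx dP mulr1 -det_mulmx oQ det1.
Qed.

(** [M] is a lift of [P] to the spin group, up to a scalar.  Since the relation is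
    linear in [u], lifts can be composed and no square roots occur. *)
Definition spin_lift P M :=
  \det M != 0 /\ forall u, spin (u *m P) *m M = M *m spin u.

Lemma spin_liftM P Q M N : spin_lift P M -> spin_lift Q N ->
  spin_lift (P *m Q) (N *m M).
Proof.
move=> [dM eM] [dN eN]; split; first by rewrite det_mulmx mulf_neq0.
by move=> u; rewrite mulmxA mulmxA eN -!mulmxA eM.
Qed.

Lemma spin_lift_lft P M (h : sphere R -> sphere R) : spin_lift P M ->
  (forall x, sphere_val (h x) = sphere_val x *m P) -> is_lft h.
Proof.
move=> [dM eM] hP; exists M => // x; apply/stereoP.
have [k k0 ek] := lf_hvec (stereo x) dM.
apply: (scalerI k0); rewrite scalemxAr -ek mulmxA hP eM -mulmxA.
by have /stereoP -> : stereo x = stereo x by [].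
Qed.

(** The half-turn about the line of [u], which need not be a unit vector. *)
Definition half_turn u : 'M[R]_3 := (2 / dotv u u) *: (u^T *m u) - 1%:M.

Lemma mul_half_turn u v : v *m half_turn u = (2 * dotv v u / dotv u u) *: u - v.
Proof.
rewrite mulmxBr mulmx1 -scalemxAr mulmxA (mx11_scalar (v *m u^T)) -/(dotv v u).
by rewrite mul_scalar_mx scalerA mulrAC.
Qed.

Lemma dotvC u v : dotv u v = dotv v u.
Proof. by rewrite !dotvE; ring. Qed.

Lemma dotvDl u v w : dotv (u + v) w = dotv u w + dotv v w.
Proof. by rewrite /dotv mulmxDl mxE. Qed.

Lemma dotvZl a u w : dotv (a *: u) w = a * dotv u w.
Proof. by rewrite /dotv -scalemxAl mxE. Qed.

Lemma dotvNl u w : dotv (- u) w = - dotv u w.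
Proof. by rewrite /dotv mulNmx mxE. Qed.

Lemma trmx_half_turn u : (half_turn u)^T = half_turn u.
Proof. by rewrite /half_turn linearB /= linearZ /= trmx_mul trmxK trmx1. Qed.

Lemma half_turnK u : u != 0 -> half_turn u *m half_turn u = 1%:M.
Proof.
move=> /dotv_gt0 u0; apply/row_matrixP=> i; rewrite !rowE mulmxA mulmx1 !mul_half_turn.
rewrite dotvDl dotvZl dotvNl opprB addrCA -scalerBl -[RHS]addr0 -(scale0r u).
by congr (_ + _ *: _); field; rewrite lt0r_neq0.
Qed.

Lemma half_turn_rotation u : u != 0 -> rotation_mx (half_turn u).
Proof.
move=> u0; have d0 := lt0r_neq0 (dotv_gt0 u0); split.
  by rewrite /orthogonal_mx trmx_half_turn half_turnK.
rewrite det_mx3E !mxE !big_ord1 !mxE /=; move: d0; rewrite dotvE => d0.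
by field.
Qed.

(** This is s(u) s(v) s(u) = 2 (u . v) s(u) - |u|^2 s(v) for Pauli matrices. *)
Lemma half_turn_lift u : u != 0 -> spin_lift (half_turn u) (spin u).
Proof.
move=> /dotv_gt0 u0; have d0 := lt0r_neq0 u0; split.
  rewrite det_mx2E !spinE; apply: contraNneq d0 => /eqP; rewrite eq_complex /= => /andP[/eqP e _].
  by apply/eqP; rewrite dotvE; lra.
move=> v; rewrite mul_half_turn.
move: d0; rewrite !dotvE => d0; apply: eq_mx2; rewrite mxE sum_ord2 [RHS]mxE sum_ord2 !spinE !mxE;
  apply/eqP; rewrite eq_complex /=; apply/andP; split; apply/eqP; by field.
Qed.

(** A rotation about the vertical axis multiplies the plane by a complex number
    q of modulus 1. *)
Lemma axial_lift P : rotation_mx P -> vec3 0 0 1 *m P = vec3 0 0 1 ->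
  exists M, spin_lift P M.
Proof.
move=> [oP dP] e3; have e := fun j => congr1 (fun A : 'rV[R]_3 => A 0 j) e3.
move: (e 0) (e 1) (e 2); rewrite !mulmx_row3E !vec3E !mul0r !add0r !mul1r => p20 p21 p22.
have o i j : \sum_k P i k * P j k = (i == j)%:R.
  have := congr1 (fun A : 'M[R]_3 => A i j) oP; rewrite !mxE => <-.
  by apply: eq_bigr => k _; rewrite !mxE.
move: (o 0 2) (o 1 2) (o 0 0) (o 0 1) (o 1 1);
  rewrite !sum_ord3 p20 p21 p22 !mulr0 !add0r !mulr1 /=.
move=> p02 p12 o00 o01 o11.
move: dP; rewrite det_mx3E p20 p21 p22 p02 p12 => dP.
move: o00 o01 dP; rewrite p02 p12 => o00 o01 dP.
have n1 : P 0 0 ^+ 2 + P 0 1 ^+ 2 = 1 by lra.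
have d1 : P 0 0 * P 1 1 - P 0 1 * P 1 0 = 1 by lra.
have o1 : P 0 0 * P 1 0 + P 0 1 * P 1 1 = 0 by lra.
(* the second row is the first one turned by a right angle *)
have p11 : P 1 1 = P 0 0.
  rewrite -[LHS]mulr1 -n1 -[RHS]mulr1 -d1 -[RHS]addr0 -(mulr0 (P 0 1)) -o1; ring.
have p10 : P 1 0 = - P 0 1.
  rewrite -[LHS]mulr1 -n1 -[P 0 1 in RHS]mulr1 -d1 -[RHS]addr0 -(mulr0 (P 0 0)) -o1; ring.
pose q : C := (P 0 0 +i* P 0 1)%C.
pose N : 'M[C]_2 := \matrix_(i < 2, j < 2) if i == j then if i == 0 then q else 1 else 0.
have NE : (N 0 0 = q) * (N 0 1 = 0) * (N 1 0 = 0) * (N 1 1 = 1) by rewrite !mxE.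
exists N; split.
  rewrite det_mx2E !NE mulr1 mulr0 subr0; apply/negP; rewrite eq_complex /= =>
    /andP[/eqP a0 /eqP b0].
  by move: n1; rewrite a0 b0; lra.
move=> u; apply: eq_mx2; rewrite mxE sum_ord2 [RHS]mxE sum_ord2 !spinE !mulmx_row3E
  p20 p21 p22 p02 p12 p11 p10 !NE; apply/eqP; rewrite eq_complex /=; apply/andP; split; apply/eqP.
all: by [ring | rewrite -[u 0 0 in RHS]mulr1 -n1; ring| rewrite -[u 0 1 in RHS]mulr1 -n1; ring].
Qed.

(** Let r be the image of the north pole e3.  The half-turn about r + e3
    exchanges r and e3, so composing with it leaves a rotation about the vertical
    axis.  If r = - e3, any horizontal axis does the same. *)
Lemma rotation_lift P : rotation_mx P -> exists M, spin_lift P M.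
Proof.
move=> rP; have [oP _] := rP; pose e3 : 'rV[R]_3 := vec3 0 0 1; pose r := e3 *m P.
have nr : dotv r r = 1.
  by rewrite orthogonal_dotv // dotvE !vec3E; ring.
suff [u u0 hu] : exists2 u, u != 0 & r *m half_turn u = e3.
  have [M lM] : exists M, spin_lift (P *m half_turn u) M.
    apply: axial_lift; first exact: rotation_mxM (half_turn_rotation u0).
    by rewrite mulmxA hu.
  exists (spin u *m M).
  have -> : P = P *m half_turn u *m half_turn u.
    by rewrite -mulmxA half_turnK ?mulmx1.
  exact: spin_liftM lM (half_turn_lift u0).
have [e|n] := eqVneq (r + e3) 0.
  exists (vec3 1 0 0).
    by apply/eqP=> /(congr1 (fun A : 'rV[R]_3 => A 0 0)); rewrite vec3E mxE; apply/eqP;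
      rewrite oner_eq0.
  have -> : r = - e3 by apply/eqP; rewrite -addr_eq0 e.
  rewrite mul_half_turn opprK (_ : dotv _ _ = 0) ?mulr0 ?mul0r ?scale0r ?add0r //.
  by rewrite dotvE !mxE /=; ring.
exists (r + e3) => //; rewrite mul_half_turn.
have rr : dotv r (r + e3) = 1 + r 0 2.
  by move: nr; rewrite !dotvE ![(_ + e3) _ _]mxE !vec3E; lra.
have d : dotv (r + e3) (r + e3) = 2 * dotv r (r + e3).
  by rewrite rr; move: nr; rewrite !dotvE ![(_ + e3) _ _]mxE !vec3E; lra.
rewrite -d divff ?scale1r; first by rewrite addrC addrA addNr add0r.
exact: lt0r_neq0 (dotv_gt0 n).
Qed.

Lemma rotation_is_lft P (h : sphere R -> sphere R) : rotation_mx P ->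
  (forall x, sphere_val (h x) = sphere_val x *m P) -> is_lft h.
Proof. by move=> /rotation_lift[M lM]; exact: spin_lift_lft lM. Qed.

End Rotation.

(** * Counting orbits of a finite group *)

Section OrbitArithmetic.
Local Open Scope nat_scope.

Lemma sumn_proper_orbits N (s : seq nat) :
  sumn s + size [seq o <- s | o != N] * N
    = sumn [seq o <- s | o != N] + size s * N.
Proof.
elim: s => //= o s IH; have [->|ne] := eqVneq o N => /=; first by nia.
by nia.
Qed.

(** With o_i = N / m_i the equation is 1/m1 + 1/m2 + 1/m3 = 1 + 2/N, whose
    solutions are the triples (2, 2, n), (2, 3, 3), (2, 3, 4) and (2, 3, 5).  The
    dihedral triples have an orbit with two points, and the others give N = 12,
    24 and 60. *)
Lemma three_orbits_bound N o1 o2 o3 m1 m2 m3 :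
  2 < o1 -> 2 < o2 -> 2 < o3 -> 1 < m1 -> 1 < m2 -> 1 < m3 ->
  N = m1 * o1 -> N = m2 * o2 -> N = m3 * o3 -> o1 + o2 + o3 = N + 2 -> N <= 60.
Proof.
(* some m_i is 2, since the sizes add up to more than N *)
have main a b c p q : 2 < a -> 2 < b -> 2 < c -> 1 < p -> 1 < q ->
    N = 2 * a -> N = p * b -> N = q * c -> a + b + c = N + 2 -> p <= q -> N <= 60.
  move=> a2 b2 c2 p1 q1 ea eb ec e pq.
  have [p4|p3] := leqP 4 p; first by nia.
  have [q6|q5] := leqP 6 q; first by have : p = 2 \/ p = 3 by [lia]; case=> ?; subst p; nia.
  have : p = 2 \/ p = 3 by lia.
  have : [\/ q = 2, q = 3, q = 4 | q = 5].
    by case: q q1 q5 {ec pq} => [|[|[|[|[|[|q]]]]]] // _ _;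
      [apply: Or41|apply: Or42|apply: Or43|apply: Or44].
  by case=> ? [] ?; subst p q; lia.
have main' a b c p q : 2 < a -> 2 < b -> 2 < c -> 1 < p -> 1 < q ->
    N = 2 * a -> N = p * b -> N = q * c -> a + b + c = N + 2 -> N <= 60.
  move=> a2 b2 c2 p1 q1 ea eb ec e; have [pq|/ltnW qp] := leqP p q; first exact: (main a b c p q).
  by apply: (main a c b q p) => //; lia.
move=> h1 h2 h3 k1 k2 k3 e1 e2 e3 e.
have [n1|n1] := leqP 3 m1; last first.
  have ? : m1 = 2 by lia.
  by subst m1; apply: (main' o1 o2 o3 m2 m3).
have [n2|n2] := leqP 3 m2; last first.
  have ? : m2 = 2 by lia.
  by subst m2; apply: (main' o2 o1 o3 m1 m3) => //; lia.
have [n3|n3] := leqP 3 m3; last first.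
  have ? : m3 = 2 by lia.
  by subst m3; apply: (main' o3 o1 o2 m1 m2) => //; lia.
by nia.
Qed.

(** Orbits of size N contribute N to both sides and can be dropped.  The k others
    have size at most N / 2, so that k N + 4 <= 4 N and k <= 3; fewer than three
    of them are too small to fulfil the equation. *)
Lemma orbit_sizes_bound N (s : seq nat) : 0 < N ->
  all (fun o => (o %| N) && (2 < o)) s ->
  sumn s + 2 * N = size s * N + 2 -> N <= 60.
Proof.
move=> N0 /allP hs e; have := sumn_proper_orbits N s.
set t := [seq o <- s | o != N] => e'.
have {e e'} e : sumn t + 2 * N = size t * N + 2 by lia.
have ht o : o \in t -> exists m, [/\ N = m * o, 1 < m & 2 < o].
  rewrite mem_filter => /andP[ne /hs/andP[/dvdnP[m em] o2]]; exists m; split=> //.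
  by case: m em ne => [|[|m]] // em; move: N0; rewrite em ?mul0n // mul1n eqxx.
have {hs}half : 2 * sumn t <= size t * N.
  elim: t ht {e} => //= o t IH ht.
  have [m [em m1 _]] := ht o (mem_head _ _).
  have := IH (fun p hp => ht p (mem_behead (s := o :: t) hp)).
  by have : 2 * o <= N by [nia]; lia.
have : size t <= 3 by nia.
case: t e half ht => [|o1 [|o2 [|o3 [|//]]]] /= e half ht _; first by lia.
- by have [m [_ _]] := ht o1 (mem_head _ _); lia.
- by have [m [_ _]] := ht o1 (mem_head _ _); lia.
have [m1 [N1 k1 h1]] := ht o1 (mem_head _ _).
have [m2 [N2 k2 h2]] : exists m, [/\ N = m * o2, 1 < m & 2 < o2] by apply: ht;
  rewrite !inE eqxx orbT.
have [m3 [N3 k3 h3]] : exists m, [/\ N = m * o3, 1 < m & 2 < o3] by apply: ht;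
  rewrite !inE eqxx !orbT.
by apply: (three_orbits_bound h1 h2 h3 k1 k2 k3 N1 N2 N3); lia.
Qed.

End OrbitArithmetic.

Section PermutationBound.
Local Open Scope group_scope.
Local Open Scope nat_scope.

(** Summed over the group, the numbers of fixed points are n for the identity
    and 2 for every other element, and Burnside's lemma makes the sum equal to
    the order times the number of orbits. *)
Lemma card_group_le60 n (G : {group {perm 'I_n}}) :
  (forall s, s \in G -> s != 1%g -> #|[set i | s i == i]| = 2) ->
  (forall i, exists s t, [/\ s \in G, t \in G & uniq [:: i; s i; t i]]) ->
  #|G| <= 60.
Proof.
move=> fix2 orb3.
pose to := perm_action 'I_n; pose orbs := [set orbit to G i | i in [set: 'I_n]].
have acts : [acts G, on [set: 'I_n] | to] by apply/actsP=> s _ i; rewrite !inE.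
have fixE s : 'Fix_([set: 'I_n] | to)[s] = [set i | s i == i].
  by apply/setP=> i; rewrite !inE finset.sub1set inE.
have FC := Frobenius_Cauchy acts; rewrite -/orbs in FC.
have G0 : 0 < #|G| by exact: cardG_gt0.
apply: (@orbit_sizes_bound _ [seq #|pred_of_set B| | B <- enum orbs]) => //.
  apply/allP=> _ /mapP[_ /[!mem_enum] /imsetP[i _ ->] ->].
  rewrite dvdn_orbit /=; have [s [t [sG tG u]]] := orb3 i.
  have /subset_leq_card : [set j | j \in [:: i; s i; t i]] \subset orbit to G i.
    apply/fintype.subsetP=> j; rewrite !inE => /or3P[]/eqP->; rewrite ?orbit_refl //;
      exact: mem_orbit.
  by apply: leq_trans; rewrite cardsE; move/card_uniqP: u => ->.
rewrite size_map -cardE -FC (bigD1 1%g) //= fixE.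
have -> : [set i : 'I_n | (1%g : {perm 'I_n}) i == i] = [set: 'I_n].
  by apply/setP=> i; rewrite !inE perm1 eqxx.
rewrite (eq_bigr (fun=> 2)); last by move=> s /andP[sG s1]; rewrite fixE fix2.
have -> : sumn [seq #|pred_of_set B| | B <- enum orbs] = #|[set: 'I_n]|.
  by rewrite (card_partition (orbit_partition acts)) sumnE big_map big_enum.
rewrite sum_nat_const.
have -> : #|[pred s | s \in G & s != 1%g]| = #|G| - 1.
  rewrite (cardsD1 1%g G) group1 addKn; apply: eq_card => s.
  by rewrite !inE andbC.
by move: G0; move: #|G| #|[set: 'I_n]| => a b a0; lia.
Qed.

End PermutationBound.

Local Open Scope classical_set_scope.

(** * Finite groups of linear fractional maps of the sphere *)

Section FiniteMoebius.
Variable R : realType.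
Local Notation S2 := (sphere R).
Implicit Types (h g : S2 -> S2) (A S : set S2) (x y : S2).

Lemma is_lft_eq3 h g x y t : is_lft h -> is_lft g ->
  x <> y -> x <> t -> y <> t -> h x = g x -> h y = g y -> h t = g t -> h = g.
Proof.
move=> lh lg nxy nxt nyt ex ey et.
have [k [lk gk kg]] := is_lft_inv lg.
have e : k \o h = id.
  by apply: (is_lft_fix3 (is_lft_comp lk lh) nxy nxt nyt); rewrite /= ?ex ?ey ?et gk.
by apply/funext=> p; rewrite -[LHS]kg -[k _]/((k \o h) p) e.
Qed.

Lemma finite_set_enum (T : Type) (B : set T) : finite_set B ->
  exists n (e : 'I_n -> T), injective e /\ forall x : T, B x <-> exists i, e i = x.
Proof.
move=> [n /card_set_bijP[f [fB finj fsurj]]].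
have /choice[e he] : forall i : 'I_n, exists x : T, B x /\ f x = i :> nat.
  by move=> i; have [x Bx fx] := fsurj i (ltn_ord i); exists x.
exists n, e; split=> [i j eij|x].
  by apply: val_inj; rewrite /= -(he i).2 -(he j).2 eij.
split=> [Bx|[i <-]]; last exact: (he i).1.
exists (Ordinal (fB x Bx)); apply: finj; rewrite ?inE ?(he _).2 //.
exact: (he _).1.
Qed.

Section Enumerated.
Variables (n : nat) (e : 'I_n -> S2).
Hypothesis e_inj : injective e.

(** [h] acts on the enumerated points [e i] by the permutation [s]. *)
Definition permutes h (s : {perm 'I_n}) := forall i, h (e i) = e (s i).

Lemma permutes_id : permutes id 1%g.
Proof. by move=> i; rewrite perm1. Qed.

Lemma permutes_comp h g s t : permutes h s -> permutes g t ->
  permutes (g \o h) (s * t)%g.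
Proof. by move=> hs gt i; rewrite /= hs gt permM. Qed.

Lemma permutes_iter h s m : permutes h s -> permutes (iter m h) (s ^+ m)%g.
Proof.
move=> hs; elim: m => [|m IH]; first exact: permutes_id.
by rewrite expgSr; apply: permutes_comp.
Qed.

Lemma permutes_perm_uniq h s t : permutes h s -> permutes h t -> s = t.
Proof. by move=> hs ht; apply/permP => i; apply: e_inj; rewrite -hs ht. Qed.

Lemma exists_permutes h : injective h -> (forall i, exists j, h (e i) = e j) ->
  exists s, permutes h s.
Proof.
move=> h_inj /choice[f hf].
have f_inj : injective f.
  by move=> i j eij; apply: e_inj; apply: h_inj; rewrite !hf eij.
by exists (perm f_inj) => i; rewrite permE.
Qed.

Hypothesis three : exists i j k : 'I_n, uniq [:: i; j; k].

Lemma permutes_lft_uniq h g s : is_lft h -> is_lft g ->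
  permutes h s -> permutes g s -> h = g.
Proof.
move=> lh lg hs gs; have [i [j [k]]] := three.
rewrite /= !inE !negb_or -!andbA => /and4P[/eqP ij /eqP ik /eqP jk _].
by apply: (@is_lft_eq3 h g (e i) (e j) (e k)) => //; rewrite ?hs ?gs // => /e_inj.
Qed.

Lemma permutes_order h s : is_lft h -> permutes h s -> iter #[s]%g h =1 id.
Proof.
move=> lh hs; have lit m : is_lft (iter m h).
  elim: m => [|m IH]; first exact: is_lft_id.
  exact: (is_lft_comp lh IH).
have := permutes_iter #[s]%g hs; rewrite expg_order => h1.
by rewrite (permutes_lft_uniq (lit _) (@is_lft_id R) h1 permutes_id).
Qed.

End Enumerated.

(** A group of linear fractional maps, as a set of self-maps of the sphere. *)
Definition lft_group (A : set (S2 -> S2)) :=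
  [/\ A id, (forall g h, A g -> A h -> A (g \o h)),
      (forall h, A h -> exists g, [/\ A g, cancel h g & cancel g h]) &
      A `<=` @is_lft R].

Lemma lft_stabilizer_group S : lft_group (lft_stabilizer S).
Proof.
split=> [|g h [lg gS] [lh hS]|h [lh hS]|h []//].
- by split; [exact: is_lft_id|rewrite image_id].
- by split; [exact: is_lft_comp|rewrite -image_comp hS gS].
- have [g [lg hg gh]] := is_lft_inv lh; exists g; split=> //; split=> //.
  rewrite -{1}hS image_comp (_ : g \o h = id) ?image_id //.
  exact/funext.
Qed.

Section Bound.
Variable A : set (S2 -> S2).
Hypothesis gA : lft_group A.
Hypothesis orbit3 : forall x, exists g h, [/\ A g, A h, x <> g x, x <> h x & g x <> h x].

Lemma lft_group_inj h : A h -> injective h.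
Proof. by case: gA => _ _ AV _ /AV[g [_ hg _]]; exact: can_inj hg. Qed.

Lemma invariant_three n (e : 'I_n -> S2) : injective e -> (0 < n)%N ->
  (forall h i, A h -> exists j, h (e i) = e j) -> exists i j k : 'I_n, uniq [:: i; j; k].
Proof.
move=> e_inj n0 inv; pose i := Ordinal n0.
have [g [h [Ag Ah n1 n2 n3]]] := orbit3 (e i).
have [[j ej] [k ek]] := (inv g i Ag, inv h i Ah).
exists i, j, k; rewrite /= !inE !negb_or -!andbA; apply/and4P; split=> //; apply/eqP=> eq.
- by apply: n1; rewrite ej eq.
- by apply: n2; rewrite ek eq.
- by apply: n3; rewrite ej ek eq.
Qed.

(** On three or more points a linear fractional map is determined by the
    permutation that it induces. *)
Lemma lft_group_finite n (e : 'I_n -> S2) : injective e -> (0 < n)%N ->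
  (forall h i, A h -> exists j, h (e i) = e j) -> finite_set A.
Proof.
move=> e_inj n0 inv; have [_ _ _ Alft] := gA.
have three := invariant_three e_inj n0 inv.
have /choice[F hF] : forall s : {perm 'I_n}, exists g,
    (exists2 h, A h & permutes e h s) -> A g /\ permutes e g s.
  move=> s; have [[h Ah hs]|no] := pselect (exists2 h, A h & permutes e h s).
    by exists h.
  by exists id => /no.
apply: (@sub_finite_set _ _ (F @` [set: {perm 'I_n}])); last first.
  by apply: finite_image; exact: finite_finset.
move=> h Ah; have [s hs] := exists_permutes e_inj (lft_group_inj Ah) (fun i => inv h i Ah).
have [AF Fs] : A (F s) /\ permutes e (F s) s by apply: hF; exists h.
by exists s => //; apply: (permutes_lft_uniq e_inj three _ _ Fs hs); apply: Alft.
Qed.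

(** The fixed points of nontrivial elements are finitely many and are permuted
    by the group, since h maps the fixed points of g to those of h g h^-1. *)
Lemma lft_group_extend n (e : 'I_n -> S2) : injective e -> (0 < n)%N ->
  (forall h i, A h -> exists j, h (e i) = e j) ->
  exists m (e' : 'I_m -> S2), [/\ injective e', (0 < m)%N,
    (forall h i, A h -> exists j, h (e' i) = e' j) &
    forall h x, A h -> h <> id -> h x = x -> exists i, e' i = x].
Proof.
move=> e_inj n0 inv; have [A1 AM AV Alft] := gA.
have three := invariant_three e_inj n0 inv.
pose S := range e `|` \bigcup_(h in A `\ id) [set x | h x = x].
have Sfin : finite_set S.
  rewrite finite_setU; split; first by apply: finite_image; exact: finite_finset.
  apply: bigcup_finite.
    by apply: sub_finite_set (lft_group_finite e_inj n0 inv) => h [].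
  move=> h [Ah nh].
  have [s hs] := exists_permutes e_inj (lft_group_inj Ah) (fun i => inv h i Ah).
  have [x [y [_ fxy]]] := is_lft_two_fixed (Alft _ Ah) nh (order_gt0 s)
    (permutes_order e_inj three (Alft _ Ah) hs).
  by apply: (@sub_finite_set _ _ [set x; y]) => [t /fxy //|]; exact: finite_set2.
have [m [e' [e'_inj Se']]] := finite_set_enum Sfin.
exists m, e'; split=> //.
- have /Se'[i _] : S (e (Ordinal n0)) by left; exists (Ordinal n0).
  exact: leq_ltn_trans (ltn_ord i).
- move=> h i Ah; suff /Se'[j <-] : S (h (e' i)) by exists j.
  have /Se' : exists j, e' j = e' i by exists i.
  case=> [[j _ <-]|[g [Ag ng] gfix]].
    by left; have [k ->] := inv h j Ah; exists k.
  right; have [k [Ak hk kh]] := AV h Ah.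
  exists (h \o g \o k); last by rewrite /= hk gfix.
  split; first by apply: (AM _ _ (AM _ _ Ah Ag) Ak).
  move=> /= e1; apply: ng; apply/funext => p.
  apply: (lft_group_inj Ah); have := congr1 (fun f => f (h p)) e1.
  by rewrite /= hk.
- by move=> h x Ah nh hx; apply/Se'; right; exists h.
Qed.

(** A group of linear fractional maps with an invariant finite set, all of whose
    orbits have three points, has at most 60 elements; so any 60 of them exhaust
    it. *)
Theorem lft_group_le60 (T : finType) (D : {set T}) (F : T -> S2 -> S2)
    n (e0 : 'I_n -> S2) :
  injective e0 -> (0 < n)%N -> (forall h i, A h -> exists j, h (e0 i) = e0 j) ->
  {in D &, injective F} -> (60 <= #|D|)%N -> (forall t, t \in D -> A (F t)) ->
  A `<=` [set F t | t in [set` D]].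
Proof.
move=> e0_inj n0 inv0 F_inj D60 FA; have [A1 AM AV Alft] := gA.
have [m [e [e_inj m0 inv fixS]]] := lft_group_extend e0_inj n0 inv0.
have three := invariant_three e_inj m0 inv.
pose G := [set s : {perm 'I_m} | `[< exists2 h, A h & permutes e h s >]]%SET.
have inG s : s \in G <-> exists2 h, A h & permutes e h s.
  by rewrite inE; split=> /asboolP.
have gG : group_set G.
  apply/group_setP; split; first by apply/inG; exists id => //; exact: permutes_id.
  move=> s t /inG[h Ah hs] /inG[g Ag gt]; apply/inG.
  by exists (g \o h); [exact: AM|exact: permutes_comp].
have GP s : s \in Group gG <-> exists2 h, A h & permutes e h s := inG s.
(* both fixed points of an element are among the points [e i] *)
have G60 : (#|Group gG| <= 60)%N.
  apply: card_group_le60 => [s /GP[h Ah hs] s1|i].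
    have nh : h <> id.
      move=> h1; move/eqP: s1; apply; apply: (permutes_perm_uniq e_inj hs).
      by rewrite h1; exact: permutes_id.
    have [x [y [nxy fxy]]] := is_lft_two_fixed (Alft _ Ah) nh (order_gt0 s)
      (permutes_order e_inj three (Alft _ Ah) hs).
    have [i ei] : exists i, e i = x by apply: (fixS h) => //; apply/fxy; left.
    have [j ej] : exists i, e i = y by apply: (fixS h) => //; apply/fxy; right.
    have -> : [set k | s k == k]%SET = [set i; j]%SET.
      apply/setP=> k; rewrite !inE; apply/eqP/orP.
        move=> sk; have : h (e k) = e k by rewrite hs sk.
        by move=> /fxy; rewrite -ei -ej => -[/e_inj ->|/e_inj ->]; [left|right].
      move=> h'; apply: e_inj; rewrite -hs; apply/fxy.
      by case: h' => /eqP ->; [left|right].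
    by rewrite cards2; case: eqP => // eij; case: nxy; rewrite -ei -ej eij.
  have [g [h [Ag Ah n1 n2 n3]]] := orbit3 (e i).
  have [s gs] := exists_permutes e_inj (lft_group_inj Ag) (fun i => inv g i Ag).
  have [t ht] := exists_permutes e_inj (lft_group_inj Ah) (fun i => inv h i Ah).
  exists s, t; split; [by apply/GP; exists g|by apply/GP; exists h|].
  rewrite /= !inE !negb_or -!andbA; apply/and4P; split=> //; apply/eqP=> eq.
  - by apply: n1; rewrite gs -eq.
  - by apply: n2; rewrite ht -eq.
  - by apply: n3; rewrite gs ht eq.
pose p t := xget 1%g [set s | permutes e (F t) s].
have pP t : t \in D -> permutes e (F t) (p t).
  move=> tD; rewrite /p; case: xgetP => [s _ //|no].
  have [s hs] := exists_permutes e_inj (lft_group_inj (FA t tD)) (fun i => inv _ i (FA t tD)).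
  by case: (no s).
have p_inj : {in D &, injective p}.
  move=> t u tD uD ptu; apply: F_inj => //.
  apply: (permutes_lft_uniq e_inj three (Alft _ (FA _ tD)) (Alft _ (FA _ uD)) (pP _ tD)).
  by rewrite ptu; exact: pP.
have pD : (p @: D)%SET = Group gG :> {set _}.
  apply/eqP; rewrite eqEcard card_in_imset // (leq_trans G60 D60) andbT.
  by apply/fintype.subsetP=> _ /imsetP[t tD ->]; apply/GP; exists (F t); [exact: FA|exact: pP].
move=> h Ah.
have [s hs] := exists_permutes e_inj (lft_group_inj Ah) (fun i => inv h i Ah).
have : s \in Group gG by apply/GP; exists h.
rewrite -pD => /imsetP[t tD est]; exists t => //.
apply: (permutes_lft_uniq e_inj three (Alft _ (FA _ tD)) (Alft _ Ah) (pP _ tD)).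
by rewrite -est.
Qed.

End Bound.
End FiniteMoebius.

(** * Evaluation of golden integers in the reals *)

Section Eval.
Variable R : realType.
Implicit Types (x y : zphi) (u v w : zvec) (M N : zmat).
Local Notation phi := (golden R).

Lemma sqrt5_sqr : Num.sqrt 5 * Num.sqrt 5 = 5 :> R.
Proof. by rewrite -expr2 sqr_sqrtr. Qed.

Lemma golden_sqr : phi * phi = phi + 1.
Proof. by rewrite /golden; have := sqrt5_sqr; lra. Qed.

Lemma golden_bounds : 21 / 13 < phi /\ phi < 34 / 21.
Proof.
have s0 : 0 <= Num.sqrt 5 :> R by rewrite sqrtr_ge0.
by rewrite /golden; have := sqrt5_sqr; split; nra.
Qed.

Lemma golden_gt0 : 0 < phi.
Proof. by have [] := golden_bounds; lra. Qed.

Lemma goldenV : phi^-1 = phi - 1.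
Proof.
have p0 : phi != 0 by rewrite gt_eqF ?golden_gt0.
by apply: (mulfI p0); rewrite mulfV // mulrBr golden_sqr; ring.
Qed.

Definition evZ (n : Z) : R := (int_of_Z n)%:~R.

Lemma evZD m n : evZ (Z.add m n) = evZ m + evZ n.
Proof. by rewrite /evZ -intrD -rmorphD. Qed.

Lemma evZN n : evZ (Z.opp n) = - evZ n.
Proof. by rewrite /evZ -mulrNz -rmorphN. Qed.

Lemma evZM m n : evZ (Z.mul m n) = evZ m * evZ n.
Proof. by rewrite /evZ -intrM -rmorphM. Qed.

Definition ev x : R := evZ x.1 + evZ x.2 * phi.

Lemma evD x y : ev (zadd x y) = ev x + ev y.
Proof. by rewrite /ev !evZD; ring. Qed.

Lemma evN x : ev (zopp x) = - ev x.
Proof. by rewrite /ev !evZN; ring. Qed.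

Lemma evM x y : ev (zmul x y) = ev x * ev y.
Proof.
rewrite /ev /= !(evZD, evZM).
rewrite [RHS](_ : _ = evZ x.1 * evZ y.1 + (evZ x.1 * evZ y.2 + evZ x.2 * evZ y.1) * phi
   + evZ x.2 * evZ y.2 * (phi * phi)); last by ring.
by rewrite golden_sqr; ring.
Qed.

Lemma ev_cst n : ev (zcst n) = evZ n.
Proof. by rewrite /ev /= [evZ 0]mulr0z mul0r addr0. Qed.

Lemma ev_gold : ev zgold = phi.
Proof. by rewrite /ev /= [evZ 0]mulr0z [evZ 1]mulr1z mul1r add0r. Qed.

Lemma ev_goldV : ev zgoldV = phi^-1.
Proof. by rewrite /ev /= [evZ 1]mulr1z [evZ _](_ : _ = -1) // goldenV mul1r addrC. Qed.

Lemma ev_sign e x : ev (zsign e x) = (-1) ^+ e * ev x.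
Proof. by case: e; rewrite /zsign ?evN ?expr1 ?mulN1r ?expr0 ?mul1r. Qed.

(** The exponent of 5 is even on the left and odd on the right. *)
Lemma nat_sqr5 (a b : nat) : (a ^ 2 = 5 * b ^ 2)%N -> b = 0%N.
Proof.
move=> e; apply/eqP; case: posnP => // b0.
have a0 : (0 < a)%N by case: a e => // /esym/eqP; rewrite muln_eq0 expn_eq0 /= eqn0Ngt b0.
have := congr1 (logn 5) e; rewrite lognM ?expn_gt0 ?b0 // !lognX (@logn_prime 5 5) //=.
by move=> /(congr1 odd); rewrite oddD !mul2n !odd_double.
Qed.

(** phi is irrational: a + b phi = 0 gives (2 a + b)^2 = 5 b^2. *)
Lemma ev_eq0 x : (ev x == 0) = (x == zcst 0).
Proof.
apply/eqP/eqP => [|->]; last by rewrite ev_cst [evZ 0]mulr0z.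
case: x => [a b]; rewrite /ev /= /evZ.
set m := int_of_Z a; set n := int_of_Z b => e.
have eN : ((2 * m + n) * (2 * m + n))%R = (5 * (n * n))%R.
  apply/eqP; rewrite -(eqr_int R) !(intrM, intrD).
  rewrite (_ : m%:~R = - (n%:~R * phi)); last by lra.
  apply/eqP; rewrite [LHS](_ : _ = n%:~R * n%:~R * (4 * (phi * phi) - 4 * phi + 1)); last by ring.
  by rewrite golden_sqr; ring.
have n0 : n = 0.
  apply/eqP; rewrite -absz_eq0; apply/eqP.
  by apply: (@nat_sqr5 (absz (2 * m + n))); rewrite -!mulnn -!abszM eN abszM.
have m0 : m = 0 by lia.
by congr pair; apply: (can_inj int_of_ZK).
Qed.

Lemma ev_pos x : zpos x -> 0 < ev x.
Proof.
rewrite /zpos /ev => /andP[/Z.ltb_lt h1 /Z.ltb_lt h2].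
have [l1 l2] := golden_bounds.
have pos n : Z.lt 0 n -> 0 < evZ n by move=> n0; rewrite /evZ ltr0z; lia.
move/pos: h1; move/pos: h2; rewrite !evZD !evZM.
rewrite [evZ 13](_ : _ = 13) // [evZ 21](_ : _ = 21) // [evZ 34](_ : _ = 34) //.
move: (evZ x.1) (evZ x.2) => a b h2 h1; have [b0|b0] := lerP 0 b.
  have : 0 <= b * (phi - 21 / 13) by apply: mulr_ge0; lra.
  by lra.
have : 0 <= - b * (34 / 21 - phi) by apply: mulr_ge0; lra.
by lra.
Qed.

Lemma ev_inj : injective ev.
Proof.
move=> x y /eqP; rewrite -subr_eq0 -evN -evD ev_eq0 => /eqP.
case: x y => [a b] [c d]; rewrite /zadd /zopp /zcst /= => -[e1 e2].
by congr pair; lia.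
Qed.

Definition evv v : 'rV[R]_3 := vec3 (ev v.1.1) (ev v.1.2) (ev v.2).

Lemma evvE v : (evv v 0 0 = ev v.1.1) * (evv v 0 1 = ev v.1.2) * (evv v 0 2 = ev v.2).
Proof. by rewrite /evv !vec3E. Qed.

Lemma evv_inj : injective evv.
Proof.
move=> [[a b] c] [[a' b'] c'] e.
have := congr1 (fun u : 'rV[R]_3 => u 0 0) e; rewrite !evvE => /ev_inj /= ->.
have := congr1 (fun u : 'rV[R]_3 => u 0 1) e; rewrite !evvE => /ev_inj /= ->.
by have := congr1 (fun u : 'rV[R]_3 => u 0 2) e; rewrite !evvE => /ev_inj /= ->.
Qed.

Lemma row_addE (a b : 'rV[R]_3) j : (a + b) 0 j = a 0 j + b 0 j.
Proof. by rewrite mxE. Qed.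

Lemma row_scaleE k (a : 'rV[R]_3) j : (k *: a) 0 j = k * a 0 j.
Proof. by rewrite mxE. Qed.

Lemma evvD u v : evv (zvadd u v) = evv u + evv v.
Proof. by apply: eq_vec3; rewrite row_addE !evvE evD. Qed.

Lemma evvZ a v : evv (zvscale a v) = ev a *: evv v.
Proof. by apply: eq_vec3; rewrite row_scaleE !evvE evM. Qed.

Lemma evvB u v : evv (zvsub u v) = evv u - evv v.
Proof. by rewrite evvD evvZ ev_cst [evZ _](_ : _ = -1) // scaleN1r. Qed.

Lemma evv_double v : evv (zvdouble v) = 2 *: evv v.
Proof. by rewrite evvD scaler_nat mulr2n. Qed.

Lemma evv_dot u v : dotv (evv u) (evv v) = ev (zdot u v).
Proof. by rewrite dotvE !evvE !evD !evM. Qed.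

Definition crossv (u v : 'rV[R]_3) : 'rV[R]_3 :=
  vec3 (u 0 1 * v 0 2 - u 0 2 * v 0 1) (u 0 2 * v 0 0 - u 0 0 * v 0 2)
       (u 0 0 * v 0 1 - u 0 1 * v 0 0).

Lemma crossvE (a b : 'rV[R]_3) :
  (crossv a b 0 0 = a 0 1 * b 0 2 - a 0 2 * b 0 1) *
  (crossv a b 0 1 = a 0 2 * b 0 0 - a 0 0 * b 0 2) *
  (crossv a b 0 2 = a 0 0 * b 0 1 - a 0 1 * b 0 0).
Proof. by rewrite /crossv !vec3E. Qed.

Lemma evv_cross u v : evv (zcross u v) = crossv (evv u) (evv v).
Proof. by apply: eq_vec3; rewrite crossvE !evvE !(evD, evN, evM). Qed.

Definition mat3 (r0 r1 r2 : 'rV[R]_3) : 'M[R]_3 :=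
  \matrix_(i < 3) [:: r0; r1; r2]`_i.

Lemma mat3_mul (r0 r1 r2 : 'rV[R]_3) (P : 'M[R]_3) :
  mat3 r0 r1 r2 *m P = mat3 (r0 *m P) (r1 *m P) (r2 *m P).
Proof. by apply/row_matrixP; elim/forall_ord3; rewrite row_mul !rowK. Qed.

Lemma det_mat3 (r0 r1 r2 : 'rV[R]_3) : \det (mat3 r0 r1 r2) = dotv r0 (crossv r1 r2).
Proof. by rewrite det_mx3E !mxE dotvE !vec3E /=; ring. Qed.

(** The stored matrix is twice the rotation. *)
Definition evm M : 'M[R]_3 := 2^-1 *: mat3 (evv M.1.1) (evv M.1.2) (evv M.2).

Lemma mul_mat3 (u r0 r1 r2 : 'rV[R]_3) :
  u *m mat3 r0 r1 r2 = u 0 0 *: r0 + u 0 1 *: r1 + u 0 2 *: r2.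
Proof. by rewrite mulmx_sum_row sum_ord3 !rowK. Qed.

Lemma evv_vm v M : evv v *m evm M = 2^-1 *: evv (zvm v M).
Proof. by rewrite -scalemxAr mul_mat3 !evvE !evvD !evvZ. Qed.

Lemma evm_mul M N : evm M *m evm N = 2^-1 *: evm (zmm M N).
Proof. by rewrite -scalemxAl mat3_mul !evv_vm scalerA /evm -scalerA; congr (_ *: _);
  apply/row_matrixP; elim/forall_ord3; rewrite !linearZ /= !rowK. Qed.

Lemma evm_double M : evm (zmdouble M) = 2 *: evm M.
Proof.
rewrite /evm !evv_double scalerA mulrC -scalerA; congr (_ *: _).
by apply/row_matrixP; elim/forall_ord3; rewrite !linearZ /= !rowK.
Qed.

Lemma evm_tr M : evm (zmtr M) = (evm M)^T.
Proof.
rewrite /evm linearZ /=; congr (_ *: _).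
by apply/matrixP; elim/forall_ord3; elim/forall_ord3; rewrite !mxE.
Qed.

Lemma evm_scalar k : evm (zmscalar k) = (2^-1 * evZ k)%:M.
Proof.
rewrite -scale_scalar_mx /evm; congr (_ *: _).
by apply/matrixP; elim/forall_ord3; elim/forall_ord3; rewrite !mxE /= ev_cst ?mulr1n ?mulr0n //.
Qed.

Lemma evm_inj : injective evm.
Proof.
have h0 : (2^-1 : R) != 0 by rewrite invr_eq0 pnatr_eq0.
move=> [[a b] c] [[a' b'] c'] /(scalerI h0) /= e.
have := congr1 (row 0) e; rewrite !rowK => /evv_inj ->.
have := congr1 (row 1) e; rewrite !rowK => /evv_inj ->.
by have := congr1 (row 2) e; rewrite !rowK => /evv_inj ->.
Qed.

End Eval.

(** * Symmetries, faces and edges of the standard dodecahedron *)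

(** Bridges the enumeration of the vertices and their definition by choices of
    signs. *)
Lemma zverts_forms : all (fun w => has (fun a => has (fun b => has (fun c =>
    w \in [:: (zsign a (zcst 1), zsign b (zcst 1), zsign c (zcst 1));
              (zcst 0, zsign a zgoldV, zsign b zgold);
              (zsign a zgoldV, zsign b zgold, zcst 0);
              (zsign a zgold, zcst 0, zsign b zgoldV)])
  [:: false; true]) [:: false; true]) [:: false; true]) zverts.
Proof. by vm_compute. Qed.

Lemma zvertsN : all (fun v => zvscale (zcst (-1)) v \in zverts) zverts.
Proof. by vm_compute. Qed.

Lemma zverts_norm : all (fun v => zdot v v == zcst 3) zverts.
Proof. by vm_compute. Qed.

Lemma uniq_map_inj (T U : eqType) (f : T -> U) (s : seq T) :
  uniq (map f s) -> {in s &, injective f}.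
Proof.
move=> us x y xs ys fxy; have i := index_mem x s; have j := index_mem y s.
rewrite -(nth_index x xs) -(nth_index x ys); congr nth; apply/eqP.
rewrite -(nth_uniq (f x) _ _ us) ?size_map ?i ?j //.
by rewrite !(nth_map x) ?i ?j // !nth_index // fxy.
Qed.

Section Standard.
Variable R : realType.
Local Notation V0 := (@standard_dodecahedron_vertices R).
Local Notation evv := (evv R).
Implicit Types (u v : 'rV[R]_3) (c d : pcode).

Lemma standard_vertexP v : V0 v <-> exists2 w, w \in zverts & v = evv w.
Proof.
have ev0 : ev R (zcst 0) = 0 by rewrite ev_cst.
have ev1 : ev R (zcst 1) = 1 by rewrite ev_cst.
have form (a b c : bool) (s := fun e : bool => (-1) ^+ e : R) : map evv
   [:: (zsign a (zcst 1), zsign b (zcst 1), zsign c (zcst 1));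
       (zcst 0, zsign a zgoldV, zsign b zgold);
       (zsign a zgoldV, zsign b zgold, zcst 0);
       (zsign a zgold, zcst 0, zsign b zgoldV)] =
   [:: vec3 (s a) (s b) (s c); vec3 0 (s a / golden R) (s b * golden R);
       vec3 (s a / golden R) (s b * golden R) 0; vec3 (s a * golden R) 0 (s b / golden R)].
  by rewrite /= /evv /= !ev_sign ev0 ev1 ev_gold ev_goldV !mulr1.
split=> [[a [b [c]]] /=|[w]].
  rewrite -form => /mapP[w wf ->]; exists w => //.
  by move: w wf; apply/allP; case: a; case: b; case: c.
move=> /(allP zverts_forms)/hasP[a _ /hasP[b _ /hasP[c _ wf]]] ->.
by exists a, b, c; rewrite /= -form; apply: map_f.
Qed.

Lemma standard_evv w : w \in zverts -> V0 (evv w).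
Proof. by move=> wv; apply/standard_vertexP; exists w. Qed.

Lemma standard_opp v : V0 v -> V0 (- v).
Proof.
move=> /standard_vertexP[w /(allP zvertsN) wv ->].
by rewrite -scaleN1r -(_ : ev R (zcst (-1)) = -1) -?evvZ ?ev_cst //; apply: standard_evv.
Qed.

Lemma standard_norm v : V0 v -> dotv v v = 3.
Proof. by move=> /standard_vertexP[w /(allP zverts_norm)/eqP e ->]; rewrite evv_dot e ev_cst. Qed.

Definition icos c : 'M[R]_3 := evm R (icos_mat c).

Lemma zsendsE p c q : zsends p c q -> evv p *m icos c = evv q.
Proof.
by move=> /eqP e; rewrite evv_vm e evv_double scalerA mulVf ?scale1r // pnatr_eq0.
Qed.

Lemma icos1 : icos code1 = 1%:M.
Proof. by rewrite /icos icos_mat1 evm_scalar [evZ _ 2](_ : _ = 2) // mulVf // pnatr_eq0. Qed.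

Lemma icosM c d : c \in codes -> d \in codes ->
  ccomp c d \in codes /\ icos c *m icos d = icos (ccomp c d).
Proof.
move=> cC dC; have /andP[cdC /eqP e] := allP (allP icos_matM c cC) d dC; split=> //.
by rewrite /icos evm_mul e evm_double scalerA mulVf ?scale1r // pnatr_eq0.
Qed.

Lemma icos_rotation c : c \in codes -> rotation_mx (icos c).
Proof.
move=> /(allP icos_mat_rotation)/andP[/eqP eO /eqP eD]; split.
  rewrite /orthogonal_mx -evm_tr evm_mul eO evm_scalar scale_scalar_mx.
  by rewrite [evZ _ 4](_ : _ = 4) // (_ : _ * _ = 1) //; field.
rewrite detZ det_mat3 -evv_cross evv_dot -/(zdet _ _ _) eD ev_cst [evZ _ 8](_ : _ = 8) //.
by rewrite !exprS expr0; field.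
Qed.

Lemma icosV c : c \in codes -> exists2 d, d \in codes & icos d = (icos c)^T.
Proof.
move=> cC; have /hasP[d dC /eqP cd] := allP icos_matV c cC; exists d => //.
have [_] := icosM cC dC; rewrite cd icos1 => e.
have [oC _] := icos_rotation cC.
by rewrite -[LHS]mul1mx -(orthogonal_mxC oC) -mulmxA e mulmx1.
Qed.

Lemma icos_inj : {in codes &, injective icos}.
Proof. by move=> c d cC dC /evm_inj; apply: (uniq_map_inj icos_mat_uniq). Qed.

Lemma standard_icos c v : c \in codes -> V0 v -> V0 (v *m icos c).
Proof.
move=> cC /standard_vertexP[w wv ->].
have /hasP[t tv /zsendsE ->] := allP (allP icos_mat_verts c cC) w wv.
exact: standard_evv.
Qed.

Lemma standard_transitive v : V0 v -> exists2 c, c \in codes & evv zp0 *m icos c = v.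
Proof.
move=> /standard_vertexP[w wv ->]; have /hasP[c cC /zsendsE e] := allP icos_transitive w wv.
by exists c.
Qed.

(** The images of [zp0], [zp1] and [zp2] form a triple of [icos_frames], and a
    linear map is determined by its values on these three vectors. *)
Lemma rotation_icos (P : 'M[R]_3) : rotation_mx P ->
  (forall v, V0 v -> V0 (v *m P)) -> exists2 c, c \in codes & P = icos c.
Proof.
move=> [oP dP] VP.
have im w : w \in zverts -> exists2 t, t \in zverts & evv w *m P = evv t.
  by move=> wv; apply/standard_vertexP/VP/standard_evv.
have [[q0 q0v e0] [q1 q1v e1] [q2 q2v e2]] :
  [/\ exists2 t, t \in zverts & evv zp0 *m P = evv t,
      exists2 t, t \in zverts & evv zp1 *m P = evv t &
      exists2 t, t \in zverts & evv zp2 *m P = evv t] by split; apply: im.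
have dots p q p' q' : evv p *m P = evv p' -> evv q *m P = evv q' -> zdot p' q' == zdot p q.
  by move=> ep eq; apply/eqP/(@ev_inj R); rewrite -!evv_dot -ep -eq orthogonal_dotv.
have det p q r : \det (mat3 (evv p) (evv q) (evv r)) = ev R (zdet p q r).
  by rewrite det_mat3 -evv_cross evv_dot.
have /hasP[c cC /and3P[/zsendsE c0 /zsendsE c1 /zsendsE c2]] :
    has (fun c => [&& zsends zp0 c q0, zsends zp1 c q1 & zsends zp2 c q2]) codes.
  apply: (allP (allP (allP icos_frames q0 q0v) q1 _)).
    by rewrite mem_filter q1v (dots _ _ _ _ e0 e1).
  rewrite !mem_filter q2v (dots _ _ _ _ e0 e2) (dots _ _ _ _ e1 e2) /= andbT.
  by apply/eqP/(@ev_inj R); rewrite -!det -e0 -e1 -e2 -mat3_mul det_mulmx dP mulr1.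
exists c => //; pose B := mat3 (evv zp0) (evv zp1) (evv zp2).
have uB : B \in unitmx by rewrite unitmxE unitfE det ev_eq0.
by rewrite -[P](mulKmx uB) -[icos c](mulKmx uB) !mat3_mul e0 e1 e2 c0 c1 c2.
Qed.

(** The plane u . x = k bounds the polytope. *)
Definition supports u (k : R) := u != 0 /\ forall v, V0 v -> dotv u v <= k.

Lemma dotv_mulT u v (P : 'M[R]_3) : dotv (u *m P^T) v = dotv u (v *m P).
Proof. by rewrite /dotv trmx_mul mulmxA. Qed.

Lemma dotvBr u v w : dotv u (v - w) = dotv u v - dotv u w.
Proof. by rewrite ![dotv u _]dotvC dotvDl dotvNl. Qed.

Lemma dotvZr a u v : dotv u (a *: v) = a * dotv u v.
Proof. by rewrite ![dotv u _]dotvC dotvZl. Qed.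

Lemma supports_icos u k c : c \in codes -> supports u k -> supports (u *m (icos c)^T) k.
Proof.
move=> cC [u0 uk]; split.
  have [oC _] := icos_rotation cC.
  by apply: contraNneq u0 => e; rewrite -[u](orthogonal_mulmxKV _ oC) e mul0mx.
by move=> v V0v; rewrite dotv_mulT; apply: uk; apply: standard_icos.
Qed.

(** The dodecahedron is centrally symmetric. *)
Lemma supports_ge0 u k v : supports u k -> V0 v -> dotv u v = k -> 0 <= k.
Proof.
move=> [_ uk] V0v e; have := uk _ (standard_opp V0v).
by rewrite -scaleN1r dotvZr e; lra.
Qed.

(** The weighted identity of a certificate, evaluated by u, contradicts
    u . a < k and u . b < k because k >= 0 and s + t >= x + y. *)
Lemma standard_edge0 u k q : supports u k -> V0 q -> q != evv zp0 ->
  (forall v, V0 v -> (dotv u v = k <-> v = evv zp0 \/ v = q)) ->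
  exists c, [/\ c \in codes, evv zp0 *m icos c = evv zp0 & evv zp1 *m icos c = q].
Proof.
move=> su /standard_vertexP[{}q qv ->] q0 uk.
have V00 : V0 (evv zp0) by apply: standard_evv.
have k0 : 0 <= k by apply: (supports_ge0 su V00); apply/uk => //; left.
have lt w : w \in zverts -> w != zp0 -> w != q -> dotv u (evv w) < k.
  move=> wv w0 wq; rewrite lt_neqAle; apply/andP; split; last by apply: su.2; apply: standard_evv.
  apply/eqP => /uk; case; first exact: standard_evv.
    by move=> /evv_inj; apply/eqP.
  by move=> /evv_inj; apply/eqP.
have nq : zp0 != q by apply: contraNneq q0 => ->.
have := allP icos_edges q qv; rewrite nq implyTb => /orP[]; last first.
  by move=> /hasP[c cC /andP[/zsendsE c0 /zsendsE c1]]; exists c.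
move=> /hasP[[[[s t] x] y] kin /hasP[a av /and3P[a0 aq /hasP[b bv /and3P[b0 bq /eqP e]]]]].
have {}e : (ev R s + ev R t) * k = ev R x * dotv u (evv a) + ev R y * dotv u (evv b).
  have e1 : dotv u (evv zp0) = k by apply/uk => //; left.
  have e2 : dotv u (evv q) = k by apply/uk; [exact: standard_evv|right].
  have := congr1 (fun w => dotv (evv w) u) e.
  by rewrite !evvD !evvZ !dotvDl !dotvZl ![dotv _ u]dotvC e1 e2 => <-; ring.
have la := lt a av a0 aq; have lb := lt b bv b0 bq.
have g1 := golden_gt0 R; have ev1 : ev R (zcst 1) = 1 by rewrite ev_cst.
have [xy0 stxy] : (0 < ev R x /\ 0 < ev R y) /\ ev R x + ev R y <= ev R s + ev R t.
  move: kin; rewrite !inE => /or3P[]/eqP[-> -> -> ->]; rewrite ?evM ?ev1 ?ev_gold.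
  - by split; [split|]; lra.
  - by split; [split|]; lra.
  - by rewrite golden_sqr; split; [split|]; lra.
exfalso; have h1 : 0 < ev R x * (k - dotv u (evv a)) by apply: mulr_gt0;
  [case: xy0|rewrite subr_gt0].
have h2 : 0 < ev R y * (k - dotv u (evv b)) by apply: mulr_gt0; [case: xy0|rewrite subr_gt0].
have h3 : 0 <= (ev R s + ev R t - (ev R x + ev R y)) * k by apply: mulr_ge0 => //; lra.
by move: h1 h2 h3 e; rewrite !mulrBr !mulrBl; lra.
Qed.

Lemma icosK c v : c \in codes -> v *m (icos c)^T *m icos c = v.
Proof. by move=> cC; apply: orthogonal_mulmxKV; have [] := icos_rotation cC. Qed.

Lemma standard_icosT c v : c \in codes -> V0 v -> V0 (v *m (icos c)^T).
Proof. by move=> cC V0v; have [d dC <-] := icosV cC; apply: standard_icos. Qed.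

(** By transitivity the first endpoint can be moved to [zp0]. *)
Lemma standard_edge u k p q : supports u k -> V0 p -> V0 q -> p != q ->
  (forall v, V0 v -> (dotv u v = k <-> v = p \/ v = q)) ->
  exists c, [/\ c \in codes, evv zp0 *m icos c = p & evv zp1 *m icos c = q].
Proof.
move=> su V0p V0q npq uk; have [c cC ep] := standard_transitive V0p.
have [oC _] := icos_rotation cC.
have [|||v V0v|d [dC d0 d1]] := @standard_edge0 (u *m (icos c)^T) k (q *m (icos c)^T).
- exact: supports_icos.
- exact: standard_icosT.
- by apply: contraNneq npq => e; rewrite -ep -e icosK.
- rewrite dotv_mulT; rewrite (uk _ (standard_icos cC V0v)); split=> -[e|e].
  + by left; rewrite -[LHS](orthogonal_mulmxK _ oC) e -ep orthogonal_mulmxK.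
  + by right; rewrite -e orthogonal_mulmxK.
  + by left; rewrite e ep.
  + by right; rewrite e icosK.
have [dcC dcE] := icosM dC cC; exists (ccomp d c); split => //.
  by rewrite -dcE mulmxA d0.
by rewrite -dcE mulmxA d1 icosK.
Qed.

End Standard.

Section Faces.
Variable R : realType.
Local Notation V0 := (@standard_dodecahedron_vertices R).
Local Notation evv := (evv R).
Local Notation icos := (icos R).
Implicit Types (u v a b : 'rV[R]_3) (c d : pcode).

(** If u is orthogonal to a and b, then n x (u x n) is a combination of n x a
    and n x b with vanishing coefficients. *)
Lemma crossv_normal u a b (n := crossv a b) :
  dotv u a = 0 -> dotv u b = 0 -> dotv n n *: u = dotv u n *: n.
Proof.
move=> ua ub; have e : dotv n n *: u = dotv u n *: n
   + dotv u b *: crossv n a + (- dotv u a) *: crossv n b.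
  have E j : (dotv u n *: n + dotv u b *: crossv n a + (- dotv u a) *: crossv n b) 0 j =
     dotv u n * n 0 j + dotv u b * crossv n a 0 j + (- dotv u a) * crossv n b 0 j.
    by rewrite 2!mxE [X in X + _ + _]mxE [X in _ + X + _]mxE [X in _ + X]mxE.
  apply: eq_vec3; rewrite E [LHS]mxE !crossvE !dotvE /n !crossvE;
  move: (u 0 0) (u 0 1) (u 0 2) (a 0 0) (a 0 1) (a 0 2) (b 0 0) (b 0 1) (b 0 2) => *; ring.
by rewrite e ua ub oppr0 !scale0r !addr0.
Qed.

(** u is a multiple l n of the cross product n of q - p0 and r - p0.  If there
    were vertices strictly on both sides of the plane, l would be both <= 0 and
    >= 0. *)
Lemma standard_face0 u k q r : supports u k -> V0 q -> V0 r ->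
  dotv u (evv zp0) = k -> dotv u q = k -> dotv u r = k ->
  crossv (q - evv zp0) (r - evv zp0) != 0 ->
  exists2 c, c \in codes & forall v, V0 v ->
    (dotv u v = k <-> exists2 w, w \in zface0 & v = evv w *m icos c).
Proof.
move=> [u0 uk] /standard_vertexP[{}q qv ->] /standard_vertexP[{}r rv ->] k0 kq kr.
rewrite -!evvB -evv_cross => n0; set zn := zcross _ _ in n0.
have [l l0 un] : exists2 l, l != 0 & u = l *: evv zn.
  have nn := lt0r_neq0 (dotv_gt0 n0).
  have := @crossv_normal u (evv q - evv zp0) (evv r - evv zp0).
  rewrite !dotvBr kq kr k0 subrr -!evvB -evv_cross -/zn => /(_ erefl erefl) e.
  have eu : u = ((dotv (evv zn) (evv zn))^-1 * dotv u (evv zn)) *: evv zn.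
    by rewrite -scalerA -e scalerA mulVf // scale1r.
  exists ((dotv (evv zn) (evv zn))^-1 * dotv u (evv zn)) => //.
  by apply: contraNneq u0 => l0; rewrite eu l0 scale0r.
have height w : dotv u (evv w) - k = l * ev R (zdot zn (zvsub w zp0)).
  by rewrite -k0 -dotvBr -evvB un dotvZl evv_dot.
have height' w : k - dotv u (evv w) = l * ev R (zdot zn (zvsub zp0 w)).
  by rewrite -k0 -dotvBr -evvB un dotvZl evv_dot.
have nz : zn != zvcst 0 0 0.
  apply: contraNneq n0 => ->.
  by apply/eqP/eq_vec3; rewrite !evvE !ev_cst mxE.
have := allP (allP icos_faces q qv) r rv; lazy beta zeta; rewrite -/zn (negbTE nz).
case: (boolP (two_sided zn)) =>
  [/andP[/hasP[v vv /(@ev_pos R) v0] /hasP[w wv /(@ev_pos R) w0]] _|_].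
  case/eqP: l0; apply: le_anti; apply/andP; split.
      by rewrite -(pmulr_lle0 _ v0) -height subr_le0; apply/uk/standard_evv.
  by rewrite -(pmulr_lge0 _ w0) -height' subr_ge0; apply/uk/standard_evv.
move=> /hasP[c cC /allP hc]; exists c => // v /standard_vertexP[{}v vv ->].
have := hc v vv; rewrite -(ev_eq0 R).
have -> : (ev R (zdot zn (zvsub v zp0)) == 0) = (dotv u (evv v) == k).
  by rewrite -[RHS]subr_eq0 height mulf_eq0 (negbTE l0).
move=> /eqP h; split=> [/eqP|[w wf e]].
  rewrite h => /mapP[w wf e]; exists w => //.
  by rewrite evv_vm -e evv_double scalerA mulVf ?scale1r // pnatr_eq0.
apply/eqP; rewrite h; apply/mapP; exists w => //.
apply: (@evv_inj R); rewrite evv_double e evv_vm scalerA mulfV ?scale1r // pnatr_eq0.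
Qed.

Lemma crossv_mul_neq0 (P : 'M[R]_3) a b : orthogonal_mx P -> crossv a b != 0 ->
  crossv (a *m P) (b *m P) != 0.
Proof.
move=> oP; apply: contraNneq => e; apply/eqP.
have dP : \det P != 0.
  have := congr1 (@determinant _ _) oP; rewrite det_mulmx det_tr det1 => h.
  by apply: contra_eq_neq h => ->; rewrite mul0r eq_sym oner_eq0.
have : dotv (crossv a b) (crossv a b) * \det P = 0.
  rewrite -det_mat3 -det_mulmx mat3_mul det_mat3 e.
  by rewrite dotvE !mxE; ring.
move/eqP; rewrite mulf_eq0 (negbTE dP) orbF => /eqP h.
by apply/eqP/negPn; apply/negP => /dotv_gt0; rewrite h ltxx.
Qed.

Lemma standard_face u k p q r : supports u k -> V0 p -> V0 q -> V0 r ->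
  dotv u p = k -> dotv u q = k -> dotv u r = k ->
  crossv (q - p) (r - p) != 0 ->
  exists2 c, c \in codes & forall v, V0 v ->
    (dotv u v = k <-> exists2 w, w \in zface0 & v = evv w *m icos c).
Proof.
move=> su V0p V0q V0r kp kq kr n0; have [c cC ep] := standard_transitive V0p.
have [oC _] := icos_rotation R cC.
have [|||||||d dC hd] := @standard_face0 (u *m (icos c)^T) k (q *m (icos c)^T) (r *m (icos c)^T).
- exact: supports_icos.
- exact: standard_icosT.
- exact: standard_icosT.
- by rewrite dotv_mulT ep.
- by rewrite dotv_mulT icosK.
- by rewrite dotv_mulT icosK.
- have -> : evv zp0 = p *m (icos c)^T by rewrite -ep orthogonal_mulmxK.
  by rewrite -!mulmxBl; apply: crossv_mul_neq0 => //; exact: orthogonal_mxT.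
have [dcC dcE] := icosM R dC cC; exists (ccomp d c) => // v V0v.
have := hd _ (standard_icosT cC V0v); rewrite dotv_mulT icosK // => ->.
split=> -[w wf e]; exists w => //.
  by rewrite -dcE mulmxA -e icosK.
by rewrite e -dcE mulmxA orthogonal_mulmxK.
Qed.

Lemma standard_face_witness :
  supports (evv zn0) (dotv (evv zn0) (evv zp0)) /\
  forall v, V0 v -> (dotv (evv zn0) v = dotv (evv zn0) (evv zp0) <->
    exists2 w, w \in zface0 & v = evv w).
Proof.
have on w : w \in zface0 -> dotv (evv zn0) (evv w) = dotv (evv zn0) (evv zp0).
  rewrite mem_filter => /andP[/eqP e _].
  by apply/eqP; rewrite -subr_eq0 -dotvBr -evvB evv_dot e ev_cst.
have off w : w \in zverts -> w \in zface0 \/ dotv (evv zn0) (evv w) < dotv (evv zn0) (evv zp0).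
  move=> wv; have /orP[wf|/(@ev_pos R)] := allP icos_face0 w wv; first by left.
  by rewrite -evv_dot evvB dotvBr subr_gt0; right.
split; first split.
- apply/eqP => /(congr1 (fun a => dotv a (evv zp0))).
  have -> : dotv (0 : 'rV[R]_3) (evv zp0) = 0 by rewrite dotvE !mxE; ring.
  by move/eqP; rewrite evv_dot ev_eq0.
- move=> v /standard_vertexP[w wv ->].
  by have [/on ->|/ltW] := off w wv.
move=> v /standard_vertexP[w wv ->]; split=> [e|[t tf /evv_inj ->]]; last exact: on.
by exists w => //; have [//|] := off w wv; rewrite e ltxx.
Qed.

Lemma standard_edge_witness :
  supports (evv (zvadd zp0 zp1)) (dotv (evv (zvadd zp0 zp1)) (evv zp0)) /\
  forall v, V0 v -> (dotv (evv (zvadd zp0 zp1)) v = dotv (evv (zvadd zp0 zp1)) (evv zp0) <->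
    v = evv zp0 \/ v = evv zp1).
Proof.
set n := zvadd zp0 zp1.
have off w : w \in zverts -> [\/ w = zp0, w = zp1 | dotv (evv n) (evv w) < dotv (evv n) (evv zp0)].
  move=> wv; have /or3P[/eqP->|/eqP->|/(@ev_pos R)] := allP icos_edge0 w wv;
    [exact: Or31|exact: Or32|].
  by rewrite -evv_dot evvB dotvBr subr_gt0; exact: Or33.
have e1 : dotv (evv n) (evv zp1) = dotv (evv n) (evv zp0) by rewrite !evv_dot.
split; first split.
- apply/eqP => /(congr1 (fun a => dotv a (evv zp0))).
  have -> : dotv (0 : 'rV[R]_3) (evv zp0) = 0 by rewrite dotvE !mxE; ring.
  by move/eqP; rewrite evv_dot ev_eq0.
- by move=> v /standard_vertexP[w wv ->]; have [->|->|/ltW] := off w wv; rewrite ?e1.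
move=> v /standard_vertexP[w wv ->]; split=> [e|[->|->]] //.
by have [->|->|] := off w wv; [left|right|rewrite e ltxx].
Qed.

End Faces.

(** * Convex hulls and maps of the sphere *)

Section Hull.
Variable R : realType.
Implicit Types (u v x y : 'rV[R]_3) (P : 'M[R]_3) (V : set 'rV[R]_3).

Lemma sub_hull V : V `<=` convex_hull V.
Proof. by move=> v Vv C [_ VC]; apply: VC. Qed.

Lemma dotvDr u v w : dotv u (v + w) = dotv u v + dotv u w.
Proof. by rewrite ![dotv u _]dotvC dotvDl. Qed.

(** The open unit ball together with V is convex, because a proper convex
    combination of two different points of the closed ball is in the open ball.
    So it contains the hull. *)
Lemma hull_unit V x : (forall v, V v -> dotv v v = 1) ->
  convex_hull V x -> dotv x x = 1 -> V x.
Proof.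
move=> V1 hx x1; have : [set y | dotv y y < 1 \/ V y] x.
  apply: hx; split; last by move=> y Vy; right.
  apply/convex_setW => y z /set_mem Cy /set_mem Cz a; set t : R := a%:num => t0 t1; apply/mem_set.
  have -> : conv a y z = t *: y + (1 - t) *: z by [].
  have [yz|yz] := eqVneq y z.
    by rewrite -yz -scalerDl addrC subrK scale1r.
  left; have le1 w : dotv w w < 1 \/ V w -> dotv w w <= 1 by case=> [/ltW//|/V1->].
  have yz0 : 0 < dotv (y - z) (y - z) by apply: dotv_gt0; rewrite subr_eq0.
  have -> : dotv (t *: y + (1 - t) *: z) (t *: y + (1 - t) *: z) =
      t * dotv y y + (1 - t) * dotv z z - t * (1 - t) * dotv (y - z) (y - z).
    by rewrite !(dotvDl, dotvNl, dotvZl, dotvBr, dotvDr, dotvZr) (dotvC z y); ring.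
  have := le1 _ Cy; have := le1 _ Cz.
  have : 0 < t * (1 - t) * dotv (y - z) (y - z) by rewrite !mulr_gt0 // subr_gt0.
  move: (dotv (y - z) _) (dotv y y) (dotv z z) => d p q; clear -t0 t1; nra.
by case=> // ; rewrite x1 ltxx.
Qed.

Lemma hull_mul V P x : (forall v, V v -> V (v *m P)) ->
  convex_hull V x -> convex_hull V (x *m P).
Proof.
move=> VP hx C [cC VC]; suff : [set y | C (y *m P)] x by [].
apply: hx; split=> [y z a /set_mem Cy /set_mem Cz|v Vv /=]; last exact/VC/VP.
apply/mem_set => /=; rewrite (_ : _ *m P = @conv _ (convex_lmodType 'rV[R]_3) a (y *m P) (z *m P)).
  by apply/set_mem/cC; apply/mem_set.
by rewrite /conv /= mulmxDl -!scalemxAl.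
Qed.

(** The vertices are the points of the hull on the unit sphere, and orthogonal
    maps preserve norms. *)
Lemma rotation_hullP V P : (forall v, V v -> dotv v v = 1) -> orthogonal_mx P ->
  [set p *m P | p in convex_hull V] = convex_hull V <->
  (forall v, V v -> V (v *m P)) /\ (forall v, V v -> V (v *m P^T)).
Proof.
move=> V1 oP; split=> [e|[VP VPt]].
  split=> v Vv; apply: hull_unit => //; rewrite ?orthogonal_dotv ?V1 //; try exact: orthogonal_mxT.
    by rewrite -e; exists v => //; apply: sub_hull.
  have : convex_hull V v by apply: sub_hull.
  by rewrite -{1}e => -[w hw <-]; rewrite orthogonal_mulmxK.
apply/seteqP; split=> [_ [v hv <-]|v hv]; first exact: hull_mul.
by exists (v *m P^T); [exact: hull_mul|rewrite orthogonal_mulmxKV].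
Qed.

End Hull.

Section SphereMaps.
Variable R : realType.
Local Notation S2 := (sphere R).
Implicit Types (u v : 'rV[R]_3) (P : 'M[R]_3) (x y : S2).

(** The north pole is a default value, for |u| <> 1. *)
Definition unit_sphere u : S2 :=
  if @idP (dotv u u == 1) is ReflectT h then Sphere h else unstereo None.

Lemma unit_sphereK u : dotv u u = 1 -> sphere_val (unit_sphere u) = u.
Proof. by move/eqP; rewrite /unit_sphere; case: {-}_ / idP. Qed.

Lemma sphere_dotv x : dotv (sphere_val x) (sphere_val x) = 1.
Proof. exact/eqP/sphere_valP. Qed.

Definition sphere_map P x : S2 := unit_sphere (sphere_val x *m P).

Lemma sphere_mapE P x : orthogonal_mx P -> sphere_val (sphere_map P x) = sphere_val x *m P.
Proof. by move=> oP; rewrite unit_sphereK // orthogonal_dotv ?sphere_dotv. Qed.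

Lemma eq_sphere_mx P P' :
  (forall x : S2, sphere_val x *m P = sphere_val x *m P') -> P = P'.
Proof.
move=> e; apply/row_matrixP => i; rewrite !rowE.
have d1 : dotv (delta_mx 0 i : 'rV[R]_3) (delta_mx 0 i) = 1.
  by rewrite /dotv trmx_delta mul_delta_mx mxE !eqxx.
by have := e (unit_sphere (delta_mx 0 i)); rewrite unit_sphereK.
Qed.

Lemma normv_mul u P : orthogonal_mx P -> normv (u *m P) = normv u.
Proof. by move=> oP; rewrite /normv orthogonal_dotv. Qed.

Lemma radial_projection_mul u P : orthogonal_mx P ->
  radial_projection (u *m P) = radial_projection u *m P.
Proof. by move=> oP; rewrite /radial_projection normv_mul // scalemxAl. Qed.

Lemma radial_projection_unit u : u != 0 ->
  dotv (radial_projection u) (radial_projection u) = 1.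
Proof.
move=> u0; rewrite /radial_projection dotvZl dotvZr /normv.
have d0 := dotv_gt0 u0; rewrite mulrA -expr2 exprVn sqr_sqrtr ?ltW // mulVf //.
exact: lt0r_neq0.
Qed.

Lemma centroid_mul (f : set 'rV[R]_3) P : orthogonal_mx P -> finite_set f ->
  centroid [set p *m P | p in f] = centroid f *m P.
Proof.
move=> oP ff.
have inj : injective (fun p : 'rV[R]_3 => p *m P).
  by move=> p q /(congr1 (mulmx^~ P^T)); rewrite /= !orthogonal_mulmxK.
rewrite /centroid fsbig_image; last by move=> p q _ _ /inj.
rewrite fset_set_image // card_imfset //= !fsbig_finite //= -scalemxAl mulmx_suml.
by [].
Qed.

End SphereMaps.

(** * The rotation group of a dodecahedron in arbitrary position *)

Section CoordinateTurns.
Variable R : realType.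
Local Notation icos := (icos R).
Implicit Types v : 'rV[R]_3.

Lemma evZ0 : evZ R 0 = 0. Proof. by []. Qed.
Lemma evZ2 : evZ R 2 = 2. Proof. by []. Qed.
Lemma evZN2 : evZ R (-2) = -2. Proof. by []. Qed.

Lemma icos_half_turn_x : exists2 c, c \in codes & forall v,
  v *m icos c = vec3 (v 0 0) (- v 0 1) (- v 0 2).
Proof.
exists half_turn_x.1 => // v; have -> : icos half_turn_x.1 = evm R half_turn_x.2 by [].
rewrite -scalemxAr mul_mat3; apply: eq_vec3; rewrite vec3E !(row_scaleE, row_addE) !evvE !ev_cst.
all: by rewrite ?evZ0 ?evZ2 ?evZN2; field.
Qed.

Lemma icos_half_turn_y : exists2 c, c \in codes & forall v,
  v *m icos c = vec3 (- v 0 0) (v 0 1) (- v 0 2).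
Proof.
exists half_turn_y.1 => // v; have -> : icos half_turn_y.1 = evm R half_turn_y.2 by [].
rewrite -scalemxAr mul_mat3; apply: eq_vec3; rewrite vec3E !(row_scaleE, row_addE) !evvE !ev_cst.
all: by rewrite ?evZ0 ?evZ2 ?evZN2; field.
Qed.

Lemma icos_vertex_turn : exists2 c, c \in codes & forall v,
  v *m icos c = vec3 (v 0 2) (v 0 0) (v 0 1).
Proof.
exists vertex_turn.1 => // v; have -> : icos vertex_turn.1 = evm R vertex_turn.2 by [].
rewrite -scalemxAr mul_mat3; apply: eq_vec3; rewrite vec3E !(row_scaleE, row_addE) !evvE !ev_cst.
all: by rewrite ?evZ0 ?evZ2 ?evZN2; field.
Qed.

(** If two coordinates of v are nonzero, the half-turns about two coordinate axes
    move v to two other points.  Otherwise v lies on a coordinate axis, and the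
    cyclic permutation of the coordinates moves it. *)
Lemma icos_orbit3 v : v != 0 -> exists c d, [/\ c \in codes, d \in codes,
  v != v *m icos c, v != v *m icos d & v *m icos c != v *m icos d].
Proof.
move=> v0; have opp0 (a : R) : a = - a -> a = 0 by move=> ?; lra.
have ne (u w : 'rV[R]_3) i : u 0 i <> w 0 i -> u != w by move=> n; apply/eqP => e; apply: n;
  rewrite e.
have [[x xC xE] [y yC yE] [t tC tE]] := And3 icos_half_turn_x icos_half_turn_y icos_vertex_turn.
have [two|] := boolP [|| (v 0 0 != 0) && (v 0 1 != 0), (v 0 0 != 0) && (v 0 2 != 0) |
                         (v 0 1 != 0) && (v 0 2 != 0)].
  exists x, y; rewrite xE yE; split=> //.
  - have [/eqP n|z1] := boolP (v 0 1 != 0); first by apply: (ne _ _ 1); rewrite vec3E => /opp0.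
    apply: (ne _ _ 2); rewrite vec3E => /opp0/eqP z2.
    by move: two; rewrite (negbTE z1) z2 !andbF.
  - have [/eqP n|z0] := boolP (v 0 0 != 0); first by apply: (ne _ _ 0); rewrite vec3E => /opp0.
    apply: (ne _ _ 2); rewrite vec3E => /opp0/eqP z2.
    by move: two; rewrite (negbTE z0) z2 !andbF.
  - have [/eqP n|z0] := boolP (v 0 0 != 0); first by apply: (ne _ _ 0); rewrite !vec3E => /opp0.
    apply: (ne _ _ 1); rewrite !vec3E => /esym/opp0/eqP z1.
    by move: two; rewrite (negbTE z0) z1 !andbF.
have [t2C t2E] := icosM R tC tC.
rewrite !negb_or !negb_and !negbK => one.
exists t, (ccomp t t); rewrite -t2E mulmxA !tE !vec3E.
have [a0|/eqP a0] := eqVneq (v 0 0) 0.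
  have [b0|/eqP b0] := eqVneq (v 0 1) 0.
    have c0 : v 0 2 <> 0 by move=> c0; case/eqP: v0; apply: eq_vec3; rewrite mxE.
    by split=> //; [apply: (ne _ _ 0)|apply: (ne _ _ 1)|apply: (ne _ _ 0)]; rewrite !vec3E;
      congruence.
  have c0 : v 0 2 = 0 by move: one; rewrite (introF eqP b0) /= => /and3P[_ _ /eqP].
  by split=> //; [apply: (ne _ _ 1)|apply: (ne _ _ 0)|apply: (ne _ _ 0)]; rewrite !vec3E;
    congruence.
have [b0 c0] : v 0 1 = 0 /\ v 0 2 = 0 by move: one; rewrite (introF eqP a0) /= =>
  /and3P[/eqP ? /eqP ? _].
by split=> //; [apply: (ne _ _ 0)|apply: (ne _ _ 0)|apply: (ne _ _ 1)]; rewrite !vec3E; congruence.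
Qed.

End CoordinateTurns.


Opaque icos code_of.

Section Dodecahedron.
Variables (R : realType) (V : set 'rV[R]_3) (Q : 'M[R]_3).
Local Notation V0 := (@standard_dodecahedron_vertices R).
Local Notation evv := (evv R).
Local Notation icos := (icos R).
Local Notation S2 := (sphere R).
Hypothesis oQ : orthogonal_mx Q.
Definition scale3 : R := (Num.sqrt 3)^-1.
Definition place (v : 'rV[R]_3) := scale3 *: (v *m Q).
Hypothesis defV : V = [set place v | v in V0].
Local Notation G := (rotation_group (convex_hull V)).
Implicit Types (u v p q : 'rV[R]_3) (c d : pcode) (x y : S2).

Definition placed_icos c : 'M[R]_3 := Q^T *m icos c *m Q.
Local Notation gicos := placed_icos.

Lemma scale3_gt0 : 0 < scale3.
Proof. by rewrite invr_gt0 sqrtr_gt0. Qed.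

Lemma place_dotv u v : dotv (place u) (place v) = scale3 ^+ 2 * dotv u v.
Proof. by rewrite /place dotvZl dotvZr orthogonal_dotv // mulrA expr2. Qed.

Lemma place_unit v : V0 v -> dotv (place v) (place v) = 1.
Proof.
move=> /standard_norm e; rewrite place_dotv e /scale3 exprVn sqr_sqrtr ?mulVf //.
Qed.

Lemma place_inj : injective place.
Proof.
move=> u v /(scalerI (lt0r_neq0 scale3_gt0)) e.
by rewrite -(orthogonal_mulmxK u oQ) e orthogonal_mulmxK.
Qed.

Lemma place_icos v c : place v *m gicos c = place (v *m icos c).
Proof. by rewrite /place /gicos -scalemxAl !mulmxA orthogonal_mulmxK. Qed.

Lemma V_unit v : V v -> dotv v v = 1.
Proof. by rewrite defV => -[w /place_unit e <-]. Qed.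

Lemma gicos_rotation c : c \in codes -> rotation_mx (gicos c).
Proof.
move=> /(icos_rotation R) rc; have := rotation_conj (orthogonal_mxT oQ) rc.
by rewrite trmxK.
Qed.

Lemma gicosM c d : c \in codes -> d \in codes ->
  ccomp c d \in codes /\ gicos c *m gicos d = gicos (ccomp c d).
Proof.
move=> cC dC; have [cdC e] := icosM R cC dC; split=> //.
by rewrite /gicos -e !mulmxA -(mulmxA _ Q Q^T) oQ mulmx1.
Qed.

Lemma gicosV c : c \in codes -> exists2 d, d \in codes & gicos d = (gicos c)^T.
Proof.
move=> cC; have [d dC e] := icosV R cC; exists d => //.
by rewrite /gicos e !trmx_mul trmxK mulmxA.
Qed.

Lemma gicos_inj : {in codes &, injective gicos}.
Proof.
move=> c d cC dC e; apply: (@icos_inj R _ _ cC dC).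
have : Q *m gicos c *m Q^T = Q *m gicos d *m Q^T by rewrite e.
by rewrite /gicos !mulmxA oQ !mul1mx -!mulmxA oQ !mulmx1.
Qed.

Lemma gicos1 : gicos code1 = 1%:M.
Proof. by rewrite /gicos icos1 mulmx1 orthogonal_mxC. Qed.

Lemma V_gicos c v : c \in codes -> V v -> V (v *m gicos c).
Proof.
rewrite defV => cC [w V0w <-]; exists (w *m icos c); last by rewrite place_icos.
exact: standard_icos.
Qed.

Lemma V_gicosT c v : c \in codes -> V v -> V (v *m (gicos c)^T).
Proof. by move=> cC Vv; have [d dC <-] := gicosV cC; exact: V_gicos. Qed.

(** Conjugation by Q reduces this to the standard dodecahedron. *)
Lemma rotation_groupP h : G h <->
  exists2 c, c \in codes & forall x, sphere_val (h x) = sphere_val x *m gicos c.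
Proof.
split=> [[P [oP dP hP /(rotation_hullP V_unit oP)[VP _]]]|[c cC hc]].
  have [c cC e] : exists2 c, c \in codes & Q *m P *m Q^T = icos c.
    apply: rotation_icos => [|v V0v]; first exact: (rotation_conj oQ).
    have /VP : V (place v) by rewrite defV; exists v.
    rewrite defV => -[w V0w ew]; suff -> : v *m (Q *m P *m Q^T) = w by [].
    have := ew; rewrite /place -scalemxAl => /(scalerI (lt0r_neq0 scale3_gt0)) e.
    by rewrite !mulmxA -e orthogonal_mulmxK.
  by exists c => // x; rewrite hP /gicos -e !mulmxA !(orthogonal_mulmxKV _ oQ).
have [oc dc] := gicos_rotation cC; exists (gicos c); split=> //.
by apply/(rotation_hullP V_unit oc); split=> v; [exact: V_gicos|exact: V_gicosT].
Qed.

Lemma sphere_map_icos c : c \in codes -> G (sphere_map (gicos c)).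
Proof.
move=> cC; apply/rotation_groupP; exists c => // x.
by rewrite sphere_mapE //; have [] := gicos_rotation cC.
Qed.

Lemma rotation_group_lft : lft_group G.
Proof.
split.
- by apply/rotation_groupP; exists code1 => // x; rewrite gicos1 mulmx1.
- move=> g h /rotation_groupP[c cC gc] /rotation_groupP[d dC hd]; apply/rotation_groupP.
  have [dcC dcE] := gicosM dC cC; exists (ccomp d c) => // x.
  by rewrite /= gc hd -dcE mulmxA.
- move=> h /rotation_groupP[c cC hc]; have [d dC e] := gicosV cC.
  have [oc _] := gicos_rotation cC.
  have od : orthogonal_mx (gicos d) by have [] := gicos_rotation dC.
  exists (sphere_map (gicos d)); split; first exact: sphere_map_icos.
    by move=> x; apply: sphere_inj; rewrite sphere_mapE // hc e orthogonal_mulmxK.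
  by move=> x; apply: sphere_inj; rewrite hc sphere_mapE // e orthogonal_mulmxKV.
- move=> h /rotation_groupP[c cC hc].
  exact: (rotation_is_lft (gicos_rotation cC) hc).
Qed.

(** The table describes matrices acting on rows from the right, so that s |-> M_s
    reverses the order of composition of maps; the transpose, which is the
    inverse, restores it. *)
Definition alt_rotation (s : {perm 'I_5}) : S2 -> S2 :=
  sphere_map (gicos (code_of s))^T.

Lemma codes_mul c d : c \in codes -> d \in codes -> ccomp c d \in codes.
Proof. by move=> cC dC; have [] := icosM R cC dC. Qed.

Lemma Alt_codes s : (s \in Alt 'I_5)%g = (code_of s \in codes).
Proof. by rewrite -(in_code_group s) (code_group_Alt codes_mul). Qed.

Lemma card_Alt5 : #|Alt 'I_5| = 60%N.
Proof. by rewrite -(card_code_group) (code_group_Alt codes_mul). Qed.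

Lemma alt_rotationE s x : s \in Alt 'I_5 ->
  sphere_val (alt_rotation s x) = sphere_val x *m (gicos (code_of s))^T.
Proof.
rewrite Alt_codes => sC; rewrite sphere_mapE //.
by apply: orthogonal_mxT; have [] := gicos_rotation sC.
Qed.

Lemma alt_rotation_in s : s \in Alt 'I_5 -> G (alt_rotation s).
Proof.
move=> sA; apply/rotation_groupP; have := sA; rewrite Alt_codes => /gicosV[d dC e].
by exists d => // x; rewrite alt_rotationE // e.
Qed.

Lemma alt_rotation_inj : {in Alt 'I_5 &, injective alt_rotation}.
Proof.
move=> s t sA tA e; apply: code_of_inj; apply: gicos_inj;
  [by rewrite -Alt_codes|by rewrite -Alt_codes|].
apply: trmx_inj; apply: eq_sphere_mx => x.
exact: etrans (esym (alt_rotationE x sA))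
  (etrans (congr1 (fun h => sphere_val (h x)) e) (alt_rotationE x tA)).
Qed.

Lemma rotation_group_A5 : isomorphic_to_A5 G.
Proof.
exists alt_rotation; split.
- move=> s t sA tA; apply/funext=> x; apply: sphere_inj.
  have e : (gicos (code_of (s * t)%g))^T = (gicos (code_of t))^T *m (gicos (code_of s))^T.
    rewrite -trmx_mul code_ofM.
    by case: (@gicosM (code_of s) (code_of t)) => [||_ ->]; rewrite -?Alt_codes.
  apply: etrans (alt_rotationE x (groupM sA tA)) _; rewrite e mulmxA.
  apply: esym; apply: etrans (alt_rotationE (alt_rotation t x) sA) _.
  exact (congr1 (fun u : 'rV[R]_3 => u *m (gicos (code_of s))^T) (alt_rotationE x tA)).
- exact alt_rotation_inj.
- apply/funext=> x; apply: sphere_inj.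
  by rewrite alt_rotationE ?group1 // code_of1 gicos1 trmx1 mulmx1.
apply/seteqP; split=> [_ [s sA <-]|h /rotation_groupP[c cC hc]]; first exact: alt_rotation_in.
have [d dC e] := gicosV cC; have [s es] := codes_code_of dC.
have sA : s \in Alt 'I_5 by rewrite Alt_codes es.
exists s => //; apply/funext=> x; apply: sphere_inj.
by rewrite alt_rotationE // es e trmxK hc.
Qed.

Lemma rotation_group_orbit3 x : exists g h, [/\ G g, G h, x <> g x, x <> h x & g x <> h x].
Proof.
pose v := sphere_val x *m Q^T.
have v0 : v != 0.
  apply/eqP => e; have := sphere_dotv x.
  rewrite -(orthogonal_dotv _ _ (orthogonal_mxT oQ)) -/v e dotvE !mxE.
  by rewrite !mulr0 !addr0 => /esym/eqP; rewrite oner_eq0.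
have [c [d [cC dC n1 n2 n3]]] := icos_orbit3 v0.
have val e : e \in codes -> sphere_val (sphere_map (gicos e) x) *m Q^T = v *m icos e.
  move=> eC; have [oe _] := gicos_rotation eC; rewrite sphere_mapE //.
  by rewrite /gicos !mulmxA orthogonal_mulmxK.
exists (sphere_map (gicos c)), (sphere_map (gicos d)); split; try exact: sphere_map_icos.
- by move=> e; case/eqP: n1; rewrite -val // -e.
- by move=> e; case/eqP: n2; rewrite -val // -e.
- move=> e; case/eqP: n3; apply: etrans (esym (val c cC)) _.
  exact (etrans (congr1 (fun y => sphere_val y *m Q^T) e) (val d dC)).
Qed.

Lemma stabilizer_sub_rotation_group (alpha : set S2) : finite_set alpha ->
  alpha !=set0 -> G `<=` lft_stabilizer alpha -> lft_stabilizer alpha `<=` G.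
Proof.
move=> af [x ax] GA; have [n [e [e_inj ae]]] := finite_set_enum af.
have sub : lft_stabilizer alpha `<=` [set alt_rotation t | t in [set` Alt 'I_5]].
  apply: (lft_group_le60 (lft_stabilizer_group alpha) _ e_inj).
  - move=> y; have [g [h [Gg Gh n1 n2 n3]]] := rotation_group_orbit3 y.
    by exists g, h; split=> //; exact: GA.
  - by have /ae[i _] := ax; exact: leq_ltn_trans (ltn_ord i).
  - move=> h i [_ ha]; suff /ae[j <-] : alpha (h (e i)) by exists j.
    by rewrite -ha; exists (e i) => //; apply/ae; exists i.
  - exact: alt_rotation_inj.
  - by rewrite card_Alt5.
  - by move=> t tA; apply/GA/alt_rotation_in.
by move=> h /sub[t tA <-]; exact: alt_rotation_in.
Qed.

End Dodecahedron.

(** * Vertex, face and edge points are orbits *)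

Opaque placed_icos.

Section Rank.
Variable R : realType.
Implicit Types a b : 'rV[R]_3.

(** If the cross product vanishes, both rows are multiples of one vector. *)
Lemma rank_crossv_neq0 a b : \rank (col_mx a b) = 2%N -> crossv a b != 0.
Proof.
move=> r2; apply/eqP => ab0.
suff [m [C e]] : exists (m : 'rV[R]_3) (C : 'cV[R]_(1 + 1)), col_mx a b = C *m m.
  have : (\rank (C *m m) <= 1)%N by apply: leq_trans (mxrankM_maxl _ _) (rank_leq_col _).
  by rewrite -e r2.
have [->|a0] := eqVneq a 0.
  exists b, (col_mx 0 1%:M); by rewrite mul_col_mx mul0mx mul1mx.
exists a, (col_mx 1%:M ((dotv a b / dotv a a)%:M)); rewrite mul_col_mx mul1mx mul_scalar_mx.
congr col_mx; have d0 := lt0r_neq0 (dotv_gt0 a0).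
have e j := congr1 (fun w : 'rV[R]_3 => w 0 j) ab0.
move: (e 0) (e 1) (e 2); rewrite !crossvE !mxE => e0 e1 e2.
apply: (scalerI d0); rewrite scalerA mulrCA divff // mulr1 !dotvE.
apply: eq_vec3; rewrite !row_scaleE; apply/eqP; rewrite -subr_eq0; apply/eqP.
- transitivity (a 0 2 * (a 0 2 * b 0 0 - a 0 0 * b 0 2) - a 0 1 * (a 0 0 * b 0 1 -
  a 0 1 * b 0 0)); first by ring.
  by rewrite e1 e2 !mulr0 subr0.
- transitivity (a 0 0 * (a 0 0 * b 0 1 - a 0 1 * b 0 0) - a 0 2 * (a 0 1 * b 0 2 -
  a 0 2 * b 0 1)); first by ring.
  by rewrite e0 e2 !mulr0 subr0.
- transitivity (a 0 1 * (a 0 1 * b 0 2 - a 0 2 * b 0 1) - a 0 0 * (a 0 2 * b 0 0 -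
  a 0 0 * b 0 2)); first by ring.
  by rewrite e0 e1 !mulr0 subr0.
Qed.

(** A relation s a + t b = 0, multiplied by b or a, gives s (a x b) = 0 and
    t (a x b) = 0. *)
Lemma crossv_neq0_rank a b : crossv a b != 0 -> \rank (col_mx a b) = 2%N.
Proof.
move=> ab0; suff /eqP : row_free (col_mx a b) by [].
apply: inj_row_free => w; rewrite -[w]hsubmxK mul_row_col.
rewrite (mx11_scalar (lsubmx w)) (mx11_scalar (rsubmx w)) !mul_scalar_mx.
set s := lsubmx w 0 0; set t := rsubmx w 0 0 => e.
have c1 : s *: crossv a b = crossv (s *: a + t *: b) b.
  by apply: eq_vec3; rewrite !(crossvE, row_scaleE, row_addE); ring.
have c2 : t *: crossv a b = crossv a (s *: a + t *: b).
  by apply: eq_vec3; rewrite !(crossvE, row_scaleE, row_addE); ring.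
have z (c : 'rV[R]_3) : crossv 0 c = 0 /\ crossv c 0 = 0.
  by split; apply: eq_vec3; rewrite crossvE !mxE; ring.
move: c1 c2; rewrite e (z b).1 (z a).2 => /eqP + /eqP.
rewrite !scaler_eq0 (negbTE ab0) !orbF => /eqP -> /eqP ->.
by rewrite -scalemx1 scale0r row_mx0.
Qed.

End Rank.

Lemma zn0_zp0_pos : zpos (zdot zn0 zp0).
Proof. by vm_compute. Qed.

Lemma zface0_verts : [&& zp0 \in zface0, zp1 \in zface0, zp2 \in zface0 & all (fun v =>
  v \in zverts) zface0].
Proof. by vm_compute. Qed.

Lemma crossvZ (R : realType) k (a b : 'rV[R]_3) :
  crossv (k *: a) (k *: b) = k ^+ 2 *: crossv a b.
Proof. by apply: eq_vec3; rewrite row_scaleE !crossvE !row_scaleE; ring. Qed.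

Section CentroidNonzero.
Variable R : realType.
Implicit Types (n v : 'rV[R]_3) (f : set 'rV[R]_3).

(** The sum of vectors in an open half-space is in that half-space. *)
Lemma centroid_neq0 n f : finite_set f -> f !=set0 ->
  (forall v, f v -> 0 < dotv n v) -> centroid f != 0.
Proof.
move=> ff [v0 fv0] pos; have v0f : v0 \in fset_set f by rewrite in_fset_set // mem_set.
rewrite /centroid scaler_eq0 negb_or invr_eq0 pnatr_eq0 cardfs_eq0.
apply/andP; split; first by apply/eqP=> e; move: v0f; rewrite e inE.
rewrite fsbig_finite //=; apply/eqP => /(congr1 (dotv n)).
rewrite (big_morph (dotv n) (id1 := 0) (op1 := +%R)); last 2 first.
- by move=> *; rewrite dotvDr.
- by rewrite dotvE !mxE; ring.
have -> : dotv n 0 = 0 by rewrite dotvE !mxE; ring.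
apply/eqP; rewrite big_seq psumr_neq0 => [|v vf].
  by apply/hasP; exists v0 => //; rewrite v0f pos.
have : v \in fset_set f by [].
by rewrite in_fset_set // => /set_mem/pos/ltW.
Qed.

End CentroidNonzero.

Section Orbits.
Variables (R : realType) (V : set 'rV[R]_3) (Q : 'M[R]_3).
Local Notation V0 := (@standard_dodecahedron_vertices R).
Local Notation evv := (evv R).
Local Notation icos := (icos R).
Local Notation S2 := (sphere R).
Local Notation place := (place Q).
Local Notation gicos := (placed_icos Q).
Local Notation scale3 := (scale3 R).
Hypothesis oQ : orthogonal_mx Q.
Hypothesis defV : V = [set place v | v in V0].
Local Notation G := (rotation_group (convex_hull V)).
Implicit Types (u v p q : 'rV[R]_3) (f : set 'rV[R]_3) (c d : pcode) (x y : S2).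

Lemma gicos_orth c : c \in codes -> orthogonal_mx (gicos c).
Proof. by case/(gicos_rotation oQ). Qed.

Lemma place_supports u k : u != 0 -> (forall v, V v -> dotv u v <= k) ->
  supports (scale3 *: (u *m Q^T)) k.
Proof.
move=> u0 uk; have E v : dotv (scale3 *: (u *m Q^T)) v = dotv u (place v).
  by rewrite dotvZl dotv_mulT /place dotvZr.
split.
  rewrite scaler_eq0 negb_or (lt0r_neq0 (scale3_gt0 R)) /=.
  by apply: contraNneq u0 => e; rewrite -[u](orthogonal_mulmxKV _ oQ) e mul0mx.
by move=> v V0v; rewrite E; apply: uk; rewrite defV; exists v.
Qed.

Lemma place_supportE u v : dotv (scale3 *: (u *m Q^T)) v = dotv u (place v).
Proof. by rewrite dotvZl dotv_mulT /place dotvZr. Qed.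

Lemma place_support_normal u v : dotv (u *m Q) (place v) = scale3 * dotv u v.
Proof. by rewrite /place dotvZr orthogonal_dotv. Qed.

Lemma supports_place u k : supports u k ->
  u *m Q != 0 /\ forall v, V v -> dotv (u *m Q) v <= scale3 * k.
Proof.
move=> [u0 uk]; split.
  by apply: contraNneq u0 => e; rewrite -[u](orthogonal_mulmxK _ oQ) e mul0mx.
move=> v; rewrite defV => -[w V0w <-]; rewrite place_support_normal.
by rewrite ler_pM2l ?scale3_gt0 //; apply: uk.
Qed.

Lemma supported_mul f c : c \in codes -> supported_vertices V f ->
  supported_vertices V [set p *m gicos c | p in f].
Proof.
move=> cC [u [k [u0 uk ->]]]; have oc := gicos_orth cC.
have E v : dotv (u *m gicos c) v = dotv u (v *m (gicos c)^T).
  by rewrite -[v in LHS](orthogonal_mulmxKV _ oc) orthogonal_dotv.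
exists (u *m gicos c), k; split.
- by apply: contraNneq u0 => e; rewrite -[u](orthogonal_mulmxK _ oc) e mul0mx.
- by move=> v Vv; rewrite E; apply: uk; apply: (V_gicosT oQ defV cC).
apply/seteqP; split=> [_ [v [Vv <-] <-]|v [Vv <-]].
  by split; [exact: (V_gicos oQ defV cC)|rewrite orthogonal_dotv].
exists (v *m (gicos c)^T); last by rewrite orthogonal_mulmxKV.
by split; [exact: (V_gicosT oQ defV cC)|rewrite E].
Qed.

Lemma vertex_points_orbit : exists x0, vertex_points V = orbit_under G x0.
Proof.
have V0p : V0 (evv zp0) by apply: standard_evv.
exists (unit_sphere (place (evv zp0))).
have x0E := unit_sphereK (place_unit oQ V0p).
apply/seteqP; split=> [x|_ [h /(rotation_groupP oQ defV)[c cC hc] <-]] /=; last first.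
  by rewrite /vertex_points /= hc x0E; apply: (V_gicos oQ defV cC); rewrite defV; exists (evv zp0).
rewrite /vertex_points /= {1}defV => -[w /standard_transitive[c cC <-] ex].
exists (sphere_map (gicos c)); first exact: (sphere_map_icos oQ defV).
apply: sphere_inj; rewrite sphere_mapE; last exact: gicos_orth.
by rewrite x0E place_icos.
Qed.

Definition face0 : set 'rV[R]_3 := [set place (evv w) | w in [set` zface0]].

Lemma finite_face0 : finite_set face0.
Proof. by apply: finite_image; exact: finite_seq. Qed.

Lemma is_face_mul f c : c \in codes -> is_face V f -> is_face V [set p *m gicos c | p in f].
Proof.
move=> cC [sf [p [q [r [fp fq fr rk]]]]]; split; first exact: supported_mul.
exists (p *m gicos c), (q *m gicos c), (r *m gicos c); split; try by [exists p|exists q|exists r].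
rewrite -!mulmxBl -mul_col_mx mxrankMfree //.
by rewrite row_free_unit; have /mulmx1_unit[] := gicos_orth cC.
Qed.

Lemma is_face0 : is_face V face0.
Proof.
have [sn fn] := standard_face_witness R; have [n0 nk] := supports_place sn.
have /and4P[f0 f1 f2 /allP fV] := zface0_verts.
split.
  exists (evv zn0 *m Q), (scale3 * dotv (evv zn0) (evv zp0)); split=> //.
  apply/seteqP; split=> [_ [w /= wf <-]|v [+ e]].
    have V0w : V0 (evv w) by apply: standard_evv; apply: fV.
    split; first by rewrite defV; exists (evv w).
    by rewrite place_support_normal; congr (_ * _); apply/fn => //; exists w.
  rewrite defV => -[w V0w ew]; move: e; rewrite -ew place_support_normal.
  move=> /(mulfI (lt0r_neq0 (scale3_gt0 R))) /fn[] // t tf et.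
  by exists t => //; rewrite -et.
exists (place (evv zp0)), (place (evv zp2)), (place (evv zp1)); split;
  try by [exists zp0|exists zp2|exists zp1].
apply: crossv_neq0_rank; have pB a b : place a - place b = (a - b) *m (scale3 *: Q).
  by rewrite /place -scalerBr -mulmxBl scalemxAr.
rewrite !pB -!scalemxAr crossvZ scaler_eq0 expf_eq0 /= (negbTE (lt0r_neq0 (scale3_gt0 R))) /=.
apply: crossv_mul_neq0 => //; rewrite -!evvB -evv_cross -/zn0.
by have [] := sn.
Qed.

(** The supporting functional of a face is pulled back to the standard position,
    where the face is a copy of [zface0]. *)
Lemma is_face_icos f : is_face V f ->
  exists2 c, c \in codes & f = [set p *m gicos c | p in face0].
Proof.
move=> [[u [k [u0 uk ->]]] [p [q [r [[Vp kp] [Vq kq] [Vr kr] rk]]]]].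
have su := place_supports u0 uk.
move: Vp Vq Vr; rewrite {1 2 3}defV => -[p' V0p ep] [q' V0q eq] [r' V0r er].
have [||||c cC hc] := @standard_face R _ k p' q' r' su V0p V0q V0r.
- by rewrite place_supportE ep.
- by rewrite place_supportE eq.
- by rewrite place_supportE er.
- have := crossv_mul_neq0 (orthogonal_mxT oQ) (rank_crossv_neq0 rk).
  rewrite -ep -eq -er /place -!scalerBr -!scalemxAl !mulmxBl !orthogonal_mulmxK //.
  by rewrite crossvZ; apply: contraNneq => ->; rewrite scaler0.
have /and4P[_ _ _ /allP fV] := zface0_verts.
exists c => //; apply/seteqP; split=> [v [+ kv]|_ [_ [w /= wf <-] <-]].
  rewrite defV => -[v' V0v ev]; move: kv; rewrite -ev -place_supportE => /hc[] // w wf ->.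
  by exists (place (evv w)); [exists w|rewrite place_icos].
have V0w : V0 (evv w *m icos c) by apply: standard_icos => //; apply: standard_evv; apply: fV.
rewrite place_icos //; split; first by rewrite defV; exists (evv w *m icos c).
by rewrite -place_supportE; apply/hc => //; exists w.
Qed.

Lemma centroid_face0_neq0 : centroid face0 != 0.
Proof.
have /and4P[f0 _ _ _] := zface0_verts; have [sn fn] := standard_face_witness R.
apply: (centroid_neq0 (n := evv zn0 *m Q)); first exact: finite_face0.
  by exists (place (evv zp0)); exists zp0.
move=> _ [w /= wf <-]; rewrite place_support_normal mulr_gt0 ?scale3_gt0 //.
have /allP fV : all (fun a => a \in zverts) zface0 by have /and4P[] := zface0_verts.
have -> : dotv (evv zn0) (evv w) = dotv (evv zn0) (evv zp0).
  by apply/fn; [apply: standard_evv; apply: fV|exists w].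
by rewrite evv_dot ev_pos // zn0_zp0_pos.
Qed.

(** The centroid and the radial projection commute with rotations, so the points
    over the faces correspond to the faces, which are copies of [face0]. *)
Lemma face_points_orbit : exists x0, face_points V = orbit_under G x0.
Proof.
exists (unit_sphere (radial_projection (centroid face0))).
have x0E := unit_sphereK (radial_projection_unit centroid_face0_neq0).
have move0 c : c \in codes -> radial_projection (centroid [set p *m gicos c | p in face0]) =
    radial_projection (centroid face0) *m gicos c.
  move=> cC; have oc := gicos_orth cC.
  by rewrite (centroid_mul oc finite_face0) (radial_projection_mul _ oc).
apply/seteqP; split=> [x [f /is_face_icos[c cC ->] ex]|
  _ [h /(rotation_groupP oQ defV)[c cC hc] <-]].
  exists (sphere_map (gicos c)); first exact: (sphere_map_icos oQ defV).
  apply: sphere_inj; rewrite sphere_mapE; last exact: gicos_orth.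
  by rewrite x0E ex move0.
exists [set p *m gicos c | p in face0]; first exact: is_face_mul is_face0.
by rewrite hc x0E move0.
Qed.

Lemma is_edge_mul p q c : c \in codes -> is_edge V p q -> is_edge V (p *m gicos c) (q *m gicos c).
Proof.
move=> cC [npq spq]; have oc := gicos_orth cC; split.
  by apply: contraNneq npq => e; rewrite -[p](orthogonal_mulmxK _ oc) e orthogonal_mulmxK.
by have := supported_mul cC spq; rewrite image_setU !image_set1.
Qed.

Lemma is_edge0 : is_edge V (place (evv zp0)) (place (evv zp1)).
Proof.
have [sn fn] := standard_edge_witness R; have [n0 nk] := supports_place sn.
have V00 : V0 (evv zp0) by apply: standard_evv.
have V01 : V0 (evv zp1) by apply: standard_evv.
split; first by apply/eqP => /(place_inj oQ)/evv_inj.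
exists (evv (zvadd zp0 zp1) *m Q), (scale3 * dotv (evv (zvadd zp0 zp1)) (evv zp0)); split=> //.
apply/seteqP; split=> [v [->|->]|v [+ e]].
- by split; [rewrite defV; exists (evv zp0)|rewrite place_support_normal].
- split; [by rewrite defV; exists (evv zp1)|rewrite place_support_normal].
  by congr (_ * _); apply/fn => //; right.
rewrite defV => -[w V0w ew]; move: e; rewrite -ew place_support_normal.
by move=> /(mulfI (lt0r_neq0 (scale3_gt0 R))) /fn[] // ->; [left|right].
Qed.

Lemma is_edge_icos p q : is_edge V p q -> exists c, [/\ c \in codes,
  p = place (evv zp0) *m gicos c & q = place (evv zp1) *m gicos c].
Proof.
move=> [npq [u [k [u0 uk epq]]]]; have su := place_supports u0 uk.
have [Vp _] : [set v | V v /\ dotv u v = k] p by rewrite -epq; left.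
have [Vq _] : [set v | V v /\ dotv u v = k] q by rewrite -epq; right.
move: Vp Vq; rewrite {1 2}defV => -[p' V0p ep] [q' V0q eq].
have [||c [cC cp cq]] := @standard_edge R _ k p' q' su V0p V0q.
- by apply: contraNneq npq => e; rewrite -ep -eq e.
- move=> v V0v; rewrite place_supportE; split=> [kv|].
    have : [set v | V v /\ dotv u v = k] (place v) by split=> //; rewrite defV; exists v.
    by rewrite -epq -ep -eq => -[/(place_inj oQ)|/(place_inj oQ)]; [left|right].
  move=> h; have : [set p; q] (place v) by case: h => ->; [left|right].
  by rewrite epq => -[].
by exists c; rewrite !place_icos // cp cq.
Qed.

Lemma edge_points_orbit : exists x0, edge_points V = orbit_under G x0.
Proof.
pose m := 2^-1 *: (place (evv zp0) + place (evv zp1)).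
have m0 : m != 0.
  apply/eqP => /(congr1 (dotv (evv zp0 *m Q))).
  have -> : dotv (evv zp0 *m Q) 0 = 0 by rewrite dotvE !mxE; ring.
  rewrite /m dotvZr dotvDr !place_support_normal -mulrDr !evv_dot -evD => /eqP.
  by rewrite !mulf_eq0 invr_eq0 pnatr_eq0 (negbTE (lt0r_neq0 (scale3_gt0 R))) ev_eq0.
have x0E := unit_sphereK (radial_projection_unit m0).
exists (unit_sphere (radial_projection m)).
have move0 c : c \in codes -> radial_projection (2^-1 *: (place (evv zp0) *m gicos c +
  place (evv zp1) *m gicos c)) =
    radial_projection m *m gicos c.
  by move=> cC; rewrite -mulmxDl scalemxAl radial_projection_mul //; exact: gicos_orth.
apply/seteqP; split=> [x [p [q [/is_edge_icos[c [cC -> ->]] ex]]]|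
    _ [h /(rotation_groupP oQ defV)[c cC hc] <-]].
  exists (sphere_map (gicos c)); first exact: (sphere_map_icos oQ defV).
  apply: sphere_inj; rewrite sphere_mapE; last exact: gicos_orth.
  by rewrite x0E ex move0.
exists (place (evv zp0) *m gicos c), (place (evv zp1) *m gicos c).
by split; [exact: is_edge_mul is_edge0|rewrite hc x0E move0].
Qed.

(** The dilation z |-> 2 z fixes the north pole and moves the point over 1, on
    the equator, to the point over 2, off the equator; a rotation would preserve
    the inner product of the two points. *)
Lemma lft_stabilizer0_not_rotation : lft_stabilizer set0 <> G.
Proof.
move=> e; pose two : R[i] := (2 +i* 0)%C.
pose D : 'M[R[i]]_2 := \matrix_(i < 2, j < 2) if i == j then if i == 0 then two else 1 else 0.
have DE : (D 0 0 = two) * (D 0 1 = 0) * (D 1 0 = 0) * (D 1 1 = 1) by rewrite !mxE.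
have dD : \det D != 0.
  by rewrite det_mx2E !DE mulr1 mulr0 subr0 eq_complex /= pnatr_eq0.
pose h : S2 -> S2 := @unstereo R \o linear_fractional D \o @stereo R.
have hE z : h (unstereo z) = unstereo (linear_fractional D z) by rewrite /h /= unstereoK.
have : lft_stabilizer set0 h by split; [exact: is_lft_unstereo|rewrite image_set0].
rewrite e => -[P [oP _ hP _]].
have D1 : linear_fractional D (Some (1 +i* 0)%C) = Some two.
  rewrite /= !DE mul0r add0r oner_eq0 divr1 addr0; congr Some.
  by apply/eqP; rewrite eq_complex /=; apply/andP; split; apply/eqP; ring.
have DN : linear_fractional D None = None by rewrite /= DE eqxx.
pose pt t : S2 := unstereo (Some (t +i* 0)%C).
have E t : dotv (sphere_val (unstereo None)) (sphere_val (pt t)) = (t ^+ 2 - 1) / (t ^+ 2 + 1) :> R.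
  by rewrite dotvE /= !vec3E expr0n /= addr0 !mul0r !add0r mul1r.
have := orthogonal_dotv (sphere_val (unstereo None)) (sphere_val (pt 1)) oP.
rewrite -!hP !hE DN D1 -/(pt 2) !E expr1n subrr mul0r => /eqP.
rewrite mulf_eq0 invr_eq0 => /orP[] /eqP; lra.
Qed.

(** The three-point orbits and the 60 elements of G make [lft_group_le60]
    applicable to the stabilizer once it contains G. *)
Theorem stabilizer_eq_iff (alpha : set S2) : finite_set alpha ->
  lft_stabilizer alpha = G <->
  alpha !=set0 /\ (forall h x, G h -> alpha x -> alpha (h x)).
Proof.
move=> af; split=> [e|[a0 inv]].
  split; last by move=> h x; rewrite -e => -[_ ha] ax; rewrite -ha; exists x.
  apply/set0P/eqP => a0; apply: lft_stabilizer0_not_rotation; by rewrite -a0.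
have [_ _ GV Glft] := rotation_group_lft oQ defV.
have sub : G `<=` lft_stabilizer alpha.
  move=> h Gh; split; first exact: Glft.
  apply/seteqP; split=> [_ [x ax <-]|x ax]; first exact: inv.
  by have [g [Gg _ gh]] := GV h Gh; exists (g x); [exact: inv|rewrite gh].
by apply/seteqP; split; [exact: (stabilizer_sub_rotation_group oQ defV)|].
Qed.

End Orbits.

(** * Unions of orbits *)

Section OrbitUnions.
Variables (R : realType) (G : set (sphere R -> sphere R)).
Hypothesis gG : lft_group G.
Implicit Types (x : sphere R) (alpha : set (sphere R)).

Lemma mem_orbit_under x : orbit_under G x x.
Proof. by have [G1 _ _ _] := gG; exists id. Qed.

Lemma orbit_under_stable x h y : G h -> orbit_under G x y -> orbit_under G x (h y).
Proof.
by have [_ GM _ _] := gG; move=> Gh [g Gg <-]; exists (h \o g) => //; exact: GM.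
Qed.

Lemma orbit_under_eq x y : orbit_under G x y -> orbit_under G x = orbit_under G y.
Proof.
have [_ GM GV _] := gG; move=> [g Gg <-]; apply/seteqP.
split=> _ [h Gh <-]; last by exists (h \o g) => //; exact: GM.
have [k [Gk gk _]] := GV g Gg; exists (h \o k); first exact: GM.
by rewrite /= gk.
Qed.

(** Two orbits are equal or disjoint, so a stable set is the union of the members
    of F that it contains. *)
Lemma union_of_orbitsP (F : set (set (sphere R))) alpha :
  (forall b, F b -> exists x, b = orbit_under G x) ->
  (forall x, exists2 b, F b & b x) ->
  (alpha !=set0 /\ (forall h x, G h -> alpha x -> alpha (h x))) <->
  exists B, [/\ B !=set0, B `<=` F & alpha = \bigcup_(b in B) b].
Proof.
move=> Forb Fcover; split=> [[[x ax] inv]|[B [[b Bb] BF ->]]].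
  pose B := [set b | F b /\ b `<=` alpha].
  have cover y : alpha y -> exists2 b, B b & b y.
    move=> ay; have [b Fb bY] := Fcover y; exists b => //; split=> //.
    have [z bz] := Forb b Fb; move: bY; rewrite bz => /orbit_under_eq -> _ [h Gh <-].
    exact: inv.
  exists B; split=> [|b [] //|]; first by have [b Bb _] := cover x ax; exists b.
  by apply/seteqP; split=> [y /cover[b Bb bY]|y [b [_ ba] /ba]] //; exists b.
split.
  have [x bx] := Forb b (BF b Bb).
  by exists x; exists b => //; rewrite bx; exact: mem_orbit_under.
move=> h x Gh [c Bc cx]; exists c => //; have [z cz] := Forb c (BF c Bc).
by move: cx; rewrite cz; exact: orbit_under_stable.
Qed.

End OrbitUnions.

Theorem theorem9 (R : realType) (V : set 'rV[R]_3)
    (hV : regular_dodecahedron_vertices V) :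
  let G := rotation_group (convex_hull V) in
  let VI := vertex_points V in
  let FI := face_points V in
  let EI := edge_points V in
  isomorphic_to_A5 G /\
  forall alpha : set (sphere R), finite_set alpha ->
    (lft_stabilizer alpha = G <->
     exists B : set (set (sphere R)),
       [/\ B !=set0,
           B `<=` [set VI; FI; EI] `|`
                  [set orbit_under G X | X in ~` (VI `|` FI `|` EI)] &
           alpha = \bigcup_(b in B) b]).
Proof.
move=> G VI FI EI; have [Q oQ defV] := hV; split; first exact: (rotation_group_A5 oQ defV).
move=> alpha alpha_fin; rewrite (stabilizer_eq_iff oQ defV alpha_fin).
apply: (union_of_orbitsP (rotation_group_lft oQ defV)) => [b|x].
  case=> [[[->|->]|->]|[X _ <-]]; last by exists X.
  - exact: (vertex_points_orbit oQ defV).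
  - exact: (face_points_orbit oQ defV).
  - exact: (edge_points_orbit oQ defV).
have [[[Vx|Fx]|Ex]|nx] := pselect ((VI `|` FI `|` EI) x).
- by exists VI => //; left; left; left.
- by exists FI => //; left; left; right.
- by exists EI => //; left; right.
exists (orbit_under G x); first by right; exists x.
exact: (mem_orbit_under (rotation_group_lft oQ defV)).
Qed.
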